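(* Let $\phi:\mathbb N\to\mathbb N$ be weakly order-preserving and let $\lambda,\kappa$ be partitions with $n$ parts such that $\phi(\lambda)=\kappa$ (entrywise). Let $\eta\in S_n(\kappa)$ and let $\mu\in S_n(\lambda)$ be the lexicographically smallest composition with $\phi(\mu)=\eta$. Then $$\frac{E^*_\mu(\boldsymbol{x};1,t)}{E^*_\eta(\boldsymbol{x};1,t)}=\frac{e^*_{\lambda'}(\boldsymbol{x};t)}{e^*_{\kappa'}(\boldsymbol{x};t)},$$ where $\lambda',\kappa'$ are the conjugate partitions and $e^*_{\nu}=\prod_ie^*_{\nu_i}$.
   Context: $\phi$ weakly order-preserving means $\phi(i)\le\phi(j)$ whenever $i\le j$. $S_n(\lambda)$ is the set of rearrangements of $\lambda$ in $\mathbb N^n$. For $\nu\in\mathbb N^n$ let $k_i(\nu)=\#\{j<i:\nu_j>\nu_i\}+\#\{j>i:\nu_j\ge\nu_i\}$ and $\overline\nu=(q^{\nu_1}t^{-k_1(\nu)},\dots,q^{\nu_n}t^{-k_n(\nu)})$. Nonsymmetric interpolation Macdonald polynomial: for $\mu\in\mathbb N^n$ with $|\mu|=d$, $E^*_\mu(\boldsymbol{x};q,t)$ is the unique polynomial of degree at most $d$ with coefficient of $x^\mu$ equal to $1$ and $E^*_\mu(\overline\nu)=0$ for all $\nu\in\mathbb N^n$ with $|\nu|\le d$, $\nu\ne\mu$. $e^*_k(x_1,\dots,x_n;t)=\sum_{S\subseteq\{1,\dots,n\},\#S=k}\prod_{i\in S}\left(x_i-\frac{t^{\#(S^c\cap\{1,\dots,i-1\})}}{t^{n-1}}\right)$,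 $e^*_0=1$. *)

(* Defs.v *)
From mathcomp Require Import all_boot all_order all_algebra.
From mathcomp Require Import mpoly.
From Stdlib Require Import ClassicalEpsilon.

Set Implicit Arguments.
Unset Strict Implicit.
Unset Printing Implicit Defensive.

Import Order.TTheory GRing.Theory.
Local Open Scope ring_scope.

(* Elements of N^n (compositions) are represented by 'X_{1..n}, the exponents *)
(* of monomials in n variables; mdeg nu is |nu|. Positions are 0-based.       *)

Definition is_part n (lam : 'X_{1..n}) : Prop :=
  forall i j : 'I_n, (i <= j)%N -> (lam j <= lam i)%N.

(* S_n(lam) *)
Definition rearr n (lam : 'X_{1..n}) : pred 'X_{1..n} :=
  [pred mu : 'X_{1..n} | perm_eq mu lam].

Definition mnm_map n (phi : nat -> nat) (mu : 'X_{1..n}) : 'X_{1..n} :=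
  [multinom phi (mu i) | i < n].

Definition lex_le n (mu nu : 'X_{1..n}) : bool :=
  ((multinom_val mu : n.-tuplelexi nat) <= multinom_val nu)%O.

(* The conjugate partition lam', with max_i lam_i parts. *)
Definition conj_part n (lam : 'X_{1..n}) : seq nat :=
  [seq #|[set i : 'I_n | (j < lam i)%N]| | j <- iota 0 (\max_(i < n) lam i)].

Definition kstat n (nu : 'X_{1..n}) (i : 'I_n) : nat :=
  (#|[set j : 'I_n | (j < i)%N && (nu i < nu j)%N]|
   + #|[set j : 'I_n | (i < j)%N && (nu i <= nu j)%N]|)%N.

Section Interpolation.
Variables (F : fieldType) (n : nat).

Definition spectral (q t : F) (nu : 'X_{1..n}) : 'I_n -> F :=
  fun i => q ^+ nu i * t ^- kstat nu i.

Definition is_Estar (q t : F) (mu : 'X_{1..n}) (E : {mpoly F[n]}) : Prop :=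
  [/\ forall m, m \in msupp E -> (mdeg m <= mdeg mu)%N,
      E@_mu = 1
    & forall nu : 'X_{1..n}, (mdeg nu <= mdeg mu)%N -> nu != mu ->
        E.@[spectral q t nu] = 0].

(* E*_mu(x;q,t), as the polynomial described by is_Estar. For q, t            *)
(* algebraically independent, exactly one polynomial satisfies is_Estar.      *)
Definition Estar (q t : F) (mu : 'X_{1..n}) : {mpoly F[n]} :=
  epsilon (inhabits 0) (is_Estar q t mu).

Definition estar (t : F) (k : nat) : {mpoly F[n]} :=
  \sum_(S : {set 'I_n} | #|S| == k) \prod_(i in S)
    ('X_i - (t ^+ #|~: S :&: [set j : 'I_n | (j < i)%N]| / t ^+ n.-1)%:MP).

Definition estar_part (t : F) (nu : seq nat) : {mpoly F[n]} :=
  \prod_(k <- nu) estar t k.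

End Interpolation.

Section Specialization.
Variable K : fieldType.

(* f has no pole at a, and f(a) = c. A relation rather than a function: the   *)
(* library's canonical representative of a fraction need not be reduced.      *)
Definition frac_value (a : K) (f : {fraction {poly K}}) (c : K) : Prop :=
  exists p d : {poly K},
    [/\ d.[a] != 0, f = tofrac p / tofrac d & c = p.[a] / d.[a]].

Definition mpoly_value n (a : K) (P : {mpoly {fraction {poly K}}[n]})
    (p : {mpoly K[n]}) : Prop :=
  forall m : 'X_{1..n}, frac_value a P@_m p@_m.

End Specialization.

(* Q(t), and Q(q,t) = Q(t)(q). *)
Notation Qt := {fraction {poly rat}}.
Notation Qqt := {fraction {poly Qt}}.

Definition tQt : Qt := tofrac 'X.
Definition tQqt : Qqt := tofrac tQt%:P.
Definition qQqt : Qqt := tofrac 'X.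

(* p = E*_mu(x;1,t): the coefficients of E*_mu(x;q,t) are all regular at      *)
(* q = 1, and p is obtained by putting q = 1 in them.                         *)
Definition Estar_q1 n (mu : 'X_{1..n}) (p : {mpoly Qt[n]}) : Prop :=
  mpoly_value 1 (Estar qQqt tQqt mu) p.

(* Main.v *)
Require Import Defs.
From mathcomp Require Import all_boot all_order all_fingroup all_algebra.
From mathcomp Require Import mpoly.
From mathcomp Require Import zify ring.
From Stdlib Require Import ClassicalEpsilon.


(** At q = 1 the eigenvalue ratios in the Knop-Sahi recursions for E*_mu depend
    only on the ranking of the positions 1, ..., n recorded by k(mu). The recursions
    are: Phi, which prepends mu_n + 1 and multiplies by x_1 - t^(1-n), and the
    exchange of two adjacent parts mu_i > mu_(i+1), which applies T_i + c with T_i a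
    Demazure-Lusztig operator. Both commute with multiplication by symmetric
    polynomials. Hence, if T consists of the first m positions in the ranking, then
    E*_(mu + 1_T) = e*_m E*_mu at q = 1: this follows by induction from the case
    mu = 0, where E*_(0,...,0,1,...,1) is symmetric at q = 1 since the last exchange
    is by T_i + 1. Minimality of mu makes mu and eta have the same ranking, so adding
    the columns of eta to mu, or those of mu to eta, expresses E*_(mu + eta) as
    E*_mu e*_(kappa') and as E*_eta e*_(lambda').

    The recursions preserve the leading coefficient 1 because the leading monomials
    of E*_mu are bounded by mu in the Bruhat order of the affine symmetric group. *)

Set Implicit Arguments.
Unset Strict Implicit.
Unset Printing Implicit Defensive.

Import GRing.Theory.
Local Open Scope ring_scope.

Local Notation "m # s" := [multinom m (s i) | i < _]
  (at level 40, left associativity, format "m # s").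

(** * Compositions *)

Section Compositions.
Variable n : nat.
Implicit Types (m mu nu : 'X_{1..n}) (i j l a b : 'I_n).

(* [a] precedes [b] when the parts are ranked as in [kstat]: decreasingly, equal
   parts from right to left. *)
Definition beats mu a b : bool :=
  (mu b < mu a)%N || (mu b == mu a) && (b < a)%N.

Definition swap i j mu : 'X_{1..n} := mu#(tperm i j).

(** The two sets counted by [kstat] lie on opposite sides of [i], so they are disjoint, and their
    union is the set of positions ranked ahead of [i]. *)
Lemma kstatE mu i : kstat mu i = #|[set l | beats mu l i]|.
Proof.
rewrite /kstat -cardsUI.
rewrite [X in (_ + X)%N]eq_card0 ?addn0; last by move=> l; rewrite !inE; lia.
apply: eq_card => l; rewrite !inE /beats.
by case: (ltngtP l i) => h; rewrite ?orbF ?orbT ?andbF ?andbT //;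
  [lia|lia|rewrite (val_inj h); lia].
Qed.

Lemma beats_irr mu a : beats mu a a = false.
Proof. by rewrite /beats !ltnn andbF. Qed.

Lemma beats_trans mu : transitive (beats mu).
Proof. move=> b a c; rewrite /beats; lia. Qed.

Lemma beats_total mu a b : a != b -> beats mu a b || beats mu b a.
Proof. by rewrite -val_eqE /beats /=; lia. Qed.

Lemma kstat_lt mu a b : beats mu a b -> (kstat mu a < kstat mu b)%N.
Proof.
move=> ab; rewrite !kstatE; apply: proper_card; apply/properP; split.
  by apply/subsetP=> l; rewrite !inE => /beats_trans; apply.
by exists a; rewrite !inE ?beats_irr.
Qed.

Lemma kstat_inj mu a b : kstat mu a = kstat mu b -> a = b.
Proof.
move=> e; apply/eqP; apply: contraPT e => /(beats_total mu).
by case/orP=> /kstat_lt; lia.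
Qed.

Lemma kstat_perm mu nu (s : 'S_n) :
    (forall a b, beats nu a b = beats mu (s a) (s b)) ->
  forall a, kstat nu a = kstat mu (s a).
Proof.
move=> h a; rewrite !kstatE -(card_imset _ (@perm_inj _ s)).
apply: eq_card => l; rewrite !inE; apply/imsetP/idP => [[l']|hl].
  by rewrite inE h => ? ->.
by exists (s^-1 l)%g; rewrite ?inE ?h ?permKV.
Qed.

Lemma swapE i j mu l :
  swap i j mu l = if l == i then mu j else if l == j then mu i else mu l.
Proof.
rewrite /swap mnmE; case: tpermP => [->|->|/eqP/negbTE-> /eqP/negbTE->];
  by rewrite ?eqxx //; case: eqP => // ->.
Qed.

Lemma swapL i j mu : swap i j mu i = mu j.
Proof. by rewrite swapE eqxx. Qed.

Lemma swapR i j mu : swap i j mu j = mu i.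
Proof. by rewrite swapE eqxx; case: eqP => // ->. Qed.

Lemma swapK i j : involutive (swap i j).
Proof. by move=> mu; rewrite /swap -mpermM tperm2 mperm1. Qed.

Lemma mdeg_swap i j mu : mdeg (swap i j mu) = mdeg mu.
Proof. exact: mdeg_mperm. Qed.

(** An adjacent exchange reverses the relative position of no pair except [i], [j], and that pair is
    not tied, so no tie-break changes. *)
Lemma beats_swap mu i j a b : j = i.+1 :> nat -> mu i != mu j ->
  beats (swap i j mu) a b = beats mu (tperm i j a) (tperm i j b).
Proof.
move=> hj hne; rewrite /beats !mnmE.
case: (tpermP i j a) => [->|->|/eqP + /eqP +];
case: (tpermP i j b) => [->|->|/eqP + /eqP +]; rewrite -?val_eqE /=; lia.
Qed.

Lemma kstat_swap mu i j a : j = i.+1 :> nat -> mu i != mu j ->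
  kstat (swap i j mu) a = kstat mu (tperm i j a).
Proof. by move=> hj hne; apply: kstat_perm => ? ?; apply: beats_swap. Qed.

(** Equal neighbours are consecutive in the ranking, the right one first; their spectral entries
    therefore differ by the factor [t]. *)
Lemma kstat_eq_adj mu i j : j = i.+1 :> nat -> mu i = mu j ->
  kstat mu i = (kstat mu j).+1.
Proof.
move=> hj hij; rewrite !kstatE.
have -> : [set l | beats mu l i] = j |: [set l | beats mu l j].
  by apply/setP=> l; rewrite !inE /beats; case: (eqVneq l j) => [->|]; rewrite -?val_eqE /=; lia.
by rewrite cardsU1 inE beats_irr.
Qed.

Definition pcyc : 'S_n := perm (@ord_pred_inj n).

Lemma pcycE i : pcyc i = (if i == 0%N :> nat then n.-1 else i.-1) :> nat.
Proof.
rewrite permE /=; case: (nat_of_ord i) (ltn_ord i) => [|k] hk.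
  by rewrite add0n modn_small //; lia.
by rewrite -[(k.+1 + n)%N.-1]/(k + n)%N modnDr modn_small //; lia.
Qed.

(* [z] is the first position: [Phi] turns [mu] into
   [(mu_n + 1, mu_1, ..., mu_{n-1})]. *)
Definition Phi (z : 'I_n) mu : 'X_{1..n} := (mu#pcyc + U_(z))%MM.

Lemma PhiE z mu i : Phi z mu i = (mu (pcyc i) + (z == i))%N.
Proof. by rewrite /Phi mnmDE mnm1E mnmE. Qed.

Lemma mdeg_Phi z mu : mdeg (Phi z mu) = (mdeg mu).+1.
Proof. by rewrite mdegD mdeg1 mdeg_mperm addn1. Qed.

Lemma Phi_surj z nu : nu z != 0%N -> exists mu, nu = Phi z mu.
Proof.
move=> h; exists [multinom (nu - U_(z))%MM (pcyc^-1 l)%g | l < n].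
apply/mnmP=> i; rewrite PhiE mnmE permK mnmBE mnm1E.
case: (z =P i) => [<-|] /=; lia.
Qed.

(** The added box makes up for the move to the front: a tie won by the last position becomes a
    strict win, and a loss by one box becomes a tie lost by the first position. *)
Lemma beats_Phi (z : 'I_n) mu a b : z = 0%N :> nat ->
  beats (Phi z mu) a b = beats mu (pcyc a) (pcyc b).
Proof.
move=> hz; rewrite /beats !PhiE !pcycE -!val_eqE /= hz.
move: (ltn_ord a) (ltn_ord b); have := pcycE a; have := pcycE b.
case: (posnP a) => ha; case: (posnP b) => hb //=; rewrite ?ha ?hb /=.
all: lia.
Qed.

Lemma kstat_Phi (z : 'I_n) mu a : z = 0%N :> nat ->
  kstat (Phi z mu) a = kstat mu (pcyc a).
Proof. by move=> hz; apply: kstat_perm => ? ?; apply: beats_Phi. Qed.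

(** The leftmost zero is ranked last. This makes the factor [x_1 - t^(1-n)] vanish at every
    composition that begins with zero. *)
Lemma kstat_first0 mu i : mu i = 0%N ->
  (forall l, (l < i)%N -> mu l != 0%N) -> kstat mu i = n.-1.
Proof.
move=> h0 hl; rewrite kstatE.
have -> : [set l | beats mu l i] = ~: [set i].
  apply/setP=> l; rewrite !inE /beats h0 -val_eqE /=.
  case: (ltngtP l i) => [/hl|h|/val_inj->]; lia.
by rewrite cardsC1 card_ord.
Qed.

(** Undoing an ascent moves a larger part to the left and lowers the sum of the [i * mu i]; a
    composition without ascents is decreasing. *)
Lemma bubble_ind (P : 'X_{1..n} -> Prop) :
  (forall mu, (forall i j, (i <= j)%N -> (mu j <= mu i)%N) -> P mu) ->
  (forall mu i j, j = i.+1 :> nat -> (mu j < mu i)%N -> P mu ->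
     P (swap i j mu)) ->
  forall mu, P mu.
Proof.
move=> hdec hsw mu.
have [k] := ubnP (\sum_(i < n) i * mu i)%N; elim: k mu => // k IH mu hk.
case: (boolP [exists i : 'I_n, exists j : 'I_n, (j == i.+1 :> nat) && (mu i < mu j)%N]).
  case/existsP=> i /existsP[j /andP[/eqP hj lt]].
  rewrite -(swapK i j mu); apply: hsw => //; first by rewrite swapL swapR.
  apply: IH; rewrite ltnS in hk; apply: leq_trans hk.
  have nij : j != i by rewrite -val_eqE /=; lia.
  rewrite (bigD1 i) // (bigD1 j) //=.
  rewrite [X in (_ <= X)%N](bigD1 i) // [X in (_ <= _ + X)%N](bigD1 j) //=.
  rewrite swapL swapR !addnA -addSn leq_add //; first by rewrite hj; nia.
  apply: eq_leq; apply: eq_bigr => l /andP[/negbTE h1 /negbTE h2].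
  by rewrite swapE h1 h2.
rewrite negb_exists => /forallP h; apply: hdec => i j.
have hs a b : b = a.+1 :> nat -> (mu b <= mu a)%N.
  move=> hb; move/existsPn: (h a) => /(_ b); rewrite hb eqxx /=; lia.
have [d] := ubnP (j - i)%N; elim: d j => // d IHd j hd.
rewrite leq_eqVlt => /orP[/eqP/val_inj-> //|lt].
have hj' : (j.-1 < n)%N by have := ltn_ord j; lia.
apply: leq_trans (hs (Ordinal hj') j _) (IHd _ _ _) => /=; lia.
Qed.

(** A nonzero decreasing composition has a nonzero first part, hence comes by [Phi] from a
    composition of smaller degree. *)
Lemma comp_ind (P : 'X_{1..n} -> Prop) :
  P 0%MM ->
  (forall (z : 'I_n) mu, z = 0%N :> nat -> P mu -> P (Phi z mu)) ->
  (forall mu i j, j = i.+1 :> nat -> (mu j < mu i)%N -> P mu ->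
     P (swap i j mu)) ->
  forall mu, P mu.
Proof.
move=> h0 hPhi hsw mu; have [k] := ubnP (mdeg mu).
elim: k mu => // k IHk mu hk; move: mu hk.
apply: (bubble_ind (P := fun mu => (mdeg mu < k.+1)%N -> P mu))
  => [mu dec hk|mu i j hj lt IH]; last first.
  by rewrite mdeg_swap => /IH; apply: hsw.
have [->//|nz] := eqVneq mu 0%MM.
have /existsP[i hi] : [exists i, mu i != 0%N].
  apply: contraR nz; rewrite negb_exists => /forallP h.
  by apply/eqP/mnmP=> i; rewrite mnm0E; apply/eqP; rewrite -[_ == _]negbK h.
have n0 : (0 < n)%N by apply: leq_ltn_trans (ltn_ord i).
have hz : mu (Ordinal n0) != 0%N.
  by have := dec (Ordinal n0) i (leq0n _); lia.
have [nu e] := Phi_surj hz; rewrite e; apply: hPhi => //; apply: IHk.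
by move: hk; rewrite e mdeg_Phi.
Qed.

End Compositions.

(** * The affine Bruhat order *)

Section AffineOrder.
Variable n : nat.
Implicit Types (m mu nu : 'X_{1..n}) (i j l a b : 'I_n).

(* Encode [m] as the set of the numbers [l + n c] with [c < m l]; [nbox m k p]
   counts its elements that are at least [p + n k].  Comparing these counts is
   the Bruhat order of the affine symmetric group on its minimal cosets. *)
Definition nbox m (k p : nat) : nat := \sum_(l < n) (m l - (k + (l < p)%N)).

Definition ale m mu : Prop :=
  forall k p, (p <= n)%N -> (nbox m k p <= nbox mu k p)%N.

(* The exponents that divided differences in the variables [i] and [j] can
   produce from [m]. *)
Definition between i j m m' : Prop :=
  [/\ forall l, l != i -> l != j -> m' l = m l,
      (m' i + m' j = m i + m j)%N
    & (maxn (m' i) (m' j) <= maxn (m i) (m j))%N].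

Lemma between_refl i j m : between i j m m.
Proof. by split. Qed.

Lemma between_swap i j m : between i j m (swap i j m).
Proof.
split; last by rewrite swapL swapR maxnC.
  by move=> l /negbTE h1 /negbTE h2; rewrite swapE h1 h2.
by rewrite swapL swapR addnC.
Qed.

Lemma between_mdeg i j m m' : i != j -> between i j m m' -> mdeg m' = mdeg m.
Proof.
move=> ij [h1 h2 _]; rewrite !mdegE (bigD1 i) // (bigD1 j) ?(eq_sym j) //=.
rewrite [RHS](bigD1 i) // [X in _ = (_ + X)%N](bigD1 j) ?(eq_sym j) //= !addnA h2.
by congr (_ + _)%N; apply: eq_bigr => l /andP[? ?]; rewrite h1.
Qed.

Lemma nboxD2 m k p i j : i != j ->
  nbox m k p = ((m i - (k + (i < p)%N)) + (m j - (k + (j < p)%N))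
    + \sum_(l < n | (l != i) && (l != j)) (m l - (k + (l < p)%N)))%N.
Proof.
by move=> ij; rewrite /nbox (bigD1 i) //= (bigD1 j) ?(eq_sym j) //= addnA.
Qed.

Lemma ale_swap mu m m' i j : j = i.+1 :> nat -> (mu j < mu i)%N ->
  ale m mu -> between i j m m' -> ale m' (swap i j mu).
Proof.
move=> hj lt le [h1 h2 h3] k p hp.
have ij : i != j by rewrite -val_eqE /=; lia.
pose rest nu p' : nat :=
  (\sum_(l < n | (l != i) && (l != j)) (nu l - (k + (l < p')%N)))%N.
have restE (nu nu' : 'X_{1..n}) p1 p2 : (forall l, l != i -> l != j -> nu l = nu' l) ->
    (forall l, l != i -> l != j -> (l < p1)%N = (l < p2)%N) ->
    rest nu p1 = rest nu' p2.
  by move=> e1 e2; apply: eq_bigr => l /andP[? ?]; rewrite e1 // e2.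
have hsw l : l != i -> l != j -> swap i j mu l = mu l.
  by move=> /negbTE e1 /negbTE e2; rewrite swapE e1 e2.
have nboxE nu p' : nbox nu k p' =
    ((nu i - (k + (i < p')%N)) + (nu j - (k + (j < p')%N)) + rest nu p')%N.
  exact: nboxD2.
rewrite !nboxE swapL swapR (restE m' m p p) // (restE (swap i j mu) mu p p) //.
(* Only the count at [p = j] separates the two positions; there the bounds at [i] and [j.+1]
   combine. Every other count is symmetric and convex in the two parts, so a more balanced pair does
   not raise it. *)
have [e|ne] := eqVneq p j.
  have := le k i (ltnW (ltn_ord i)); have := le k j.+1 (ltn_ord j).
  rewrite !nboxE e !ltnn ltnSn.
  have -> : (i < j)%N by rewrite hj.
  have -> : (i < j.+1)%N by rewrite hj; lia.
  have -> : (j < i)%N = false by rewrite hj; lia.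
  have near nu : (rest nu i = rest nu j) * (rest nu j.+1 = rest nu j).
    by split; apply: restE => // l; rewrite -!val_eqE /=; lia.
  rewrite !near; lia.
have := le k p hp; rewrite !nboxE.
have -> : (j < p)%N = (i < p)%N by move: ne; rewrite hj; lia.
case: (i < p)%N; lia.
Qed.

Lemma ale_off mu m i j : j = i.+1 :> nat -> (mu j < mu i)%N ->
  ale m mu -> (forall l, l != i -> l != j -> m l = mu l) ->
  (maxn (m i) (m j) <= mu i)%N.
Proof.
move=> hj lt le h1.
have ij : i != j by rewrite -val_eqE /=; lia.
(* No box of [mu] at [i] or [j] is counted from level [mu i] on, so this count bounds both parts of
   [m]. *)
have := le (mu i) 0%N (leq0n _); rewrite !(nboxD2 _ _ _ ij) !ltn0.
have -> : (\sum_(l < n | (l != i) && (l != j)) (m l - (mu i + (l < 0)%N)) =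
  \sum_(l < n | (l != i) && (l != j)) (mu l - (mu i + (l < 0)%N)))%N.
  by apply: eq_bigr => l /andP[? ?]; rewrite h1.
rewrite leq_add2r; lia.
Qed.

(** The top box of the larger part is counted from position [j] on when the part sits at [j], but
    not when it sits at [i]: one count separates the two. *)
Lemma ale_swapF mu i j : j = i.+1 :> nat -> (mu j < mu i)%N ->
  ~ ale (swap i j mu) mu.
Proof.
move=> hj lt /(_ (mu i).-1 j (ltnW (ltn_ord j))).
have ij : i != j by rewrite -val_eqE /=; lia.
rewrite !(nboxD2 _ _ _ ij) ltnn swapL swapR.
have -> : (i < j)%N by rewrite hj.
have -> : (\sum_(l < n | (l != i) && (l != j)) (swap i j mu l - ((mu i).-1 + (l < j)%N)) =
  \sum_(l < n | (l != i) && (l != j)) (mu l - ((mu i).-1 + (l < j)%N)))%N.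
  by apply: eq_bigr => l /andP[/negbTE h1 /negbTE h2]; rewrite swapE h1 h2.
rewrite leq_add2r; lia.
Qed.

(** On the encoding sets, [Phi] adds one to every number and inserts 0, so the counts are shifted by
    one place. *)
Lemma nbox_Phi (z : 'I_n) mu k p : z = 0%N :> nat -> (p <= n)%N ->
  nbox (Phi z mu) k p =
  if p is p'.+1 then nbox mu k p'
  else if k is k'.+1 then nbox mu k' n.-1 else (mdeg mu).+1.
Proof.
move=> hz hp; rewrite /nbox.
have lz l : (z == l) = (l == 0%N :> nat) by rewrite -val_eqE /= hz eq_sym.
have H (G : 'I_n -> nat) : (forall l, (Phi z mu l - (k + (l < p)) = G (pcyc n l))%N) ->
    (\sum_(l < n) (Phi z mu l - (k + (l < p))) = \sum_(l < n) G l)%N.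
  by move=> hG; rewrite [RHS](reindex_inj (@perm_inj _ (pcyc n))); apply: eq_bigr.
case: p hp H => [|p] hp H; first case: k H => [|k] H.
- rewrite -(mdeg_Phi z) mdegE; apply: eq_bigr => l _; rewrite ltn0; lia.
- apply: H => l; rewrite PhiE lz pcycE ltn0; have := ltn_ord l.
  case: (posnP l) => h; rewrite ?h ?eqxx; first by rewrite ltnn; lia.
  by lia.
apply: H => l; rewrite PhiE lz pcycE; have := ltn_ord l.
case: (posnP l) => h; rewrite ?h ?eqxx; first by lia.
by lia.
Qed.

Lemma ale_Phi (z : 'I_n) m mu : z = 0%N :> nat -> mdeg m = mdeg mu ->
  ale m mu -> ale (Phi z m) (Phi z mu).
Proof.
move=> hz hd le k p hp; rewrite !nbox_Phi //.
case: p hp => [|p] hp; last by apply: le; lia.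
by case: k => [|k]; [rewrite hd | apply: le; lia].
Qed.

End AffineOrder.

(** * Demazure-Lusztig operators *)

Section Hecke.
Variables (n : nat) (R : idomainType).
Implicit Types (m mu nu : 'X_{1..n}) (i j l : 'I_n) (f g e : {mpoly R[n]}) (t : R).

Definition upd2 i j m (c d : nat) : 'X_{1..n} :=
  [multinom if l == i then c else if l == j then d else m l | l < n].

(** The divided difference of ['X_[m]] as a geometric sum. Truncated subtraction empties one of the
    two sums, depending on which of [m i], [m j] is larger. *)
Definition ddm i j m : {mpoly R[n]} :=
  \sum_(l < m i - m j) 'X_[upd2 i j m (m i - l.+1) (m j + l)]
  - \sum_(l < m j - m i) 'X_[upd2 i j m (m j - l.+1) (m i + l)].

(* the divided difference [(f - s f) / ('X_i - 'X_j)] *)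
Definition dd i j f : {mpoly R[n]} := \sum_(m <- msupp f) f@_m *: ddm i j m.

(* the Demazure-Lusztig operator: it satisfies [(T - t) (T + 1) = 0] and acts
   as [t] on polynomials symmetric in ['X_i] and ['X_j] *)
Definition hecke t i j f : {mpoly R[n]} :=
  msym (tperm i j) f + (t - 1) *: (f - 'X_i * dd i j f).

Lemma mulXi_upd2 i j m (c d : nat) : i != j ->
  'X_i * 'X_[upd2 i j m c d] = 'X_[upd2 i j m c.+1 d] :> {mpoly R[n]}.
Proof.
move=> ij; rewrite -mpolyXD; congr 'X_[_]; apply/mnmP=> l.
by rewrite mnmDE mnm1E !mnmE eq_sym; case: eqP.
Qed.

Lemma mulXj_upd2 i j m (c d : nat) : i != j ->
  'X_j * 'X_[upd2 i j m c d] = 'X_[upd2 i j m c d.+1] :> {mpoly R[n]}.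
Proof.
move=> ij; rewrite -mpolyXD; congr 'X_[_]; apply/mnmP=> l.
rewrite mnmDE mnm1E !mnmE eq_sym; case: (l =P i) => [->|_].
  by rewrite (negbTE ij).
by case: eqP.
Qed.

Lemma upd2_id i j m : upd2 i j m (m i) (m j) = m.
Proof. by apply/mnmP=> l; rewrite mnmE; case: eqP => [->//|_]; case: eqP => [->|]. Qed.

Lemma upd2_swap i j m : upd2 i j m (m j) (m i) = swap i j m.
Proof. by apply/mnmP=> l; rewrite mnmE swapE. Qed.

Lemma telescope_upd2 i j m (c d : nat) : i != j -> (d <= c)%N ->
  ('X_i - 'X_j) * (\sum_(l < c - d) 'X_[upd2 i j m (c - l.+1) (d + l)]) =
  'X_[upd2 i j m c d] - 'X_[upd2 i j m d c] :> {mpoly R[n]}.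
Proof.
move=> ij dc; rewrite mulr_sumr.
pose h (l : nat) : {mpoly R[n]} := - 'X_[upd2 i j m (c - l) (d + l)].
rewrite (eq_bigr (fun l : 'I_(c - d) => h l.+1 - h l)) => [|l _].
  rewrite -(big_mkord xpredT (fun l : nat => h l.+1 - h l)) telescope_sumr //.
  by rewrite /h subn0 addn0 opprK addrC subKn // subnKC.
rewrite mulrBl mulXi_upd2 // mulXj_upd2 // /h opprK addrC addnS.
by have -> : (c - l.+1).+1 = (c - l)%N by have := ltn_ord l; lia.
Qed.

Lemma ddmE i j m : i != j ->
  ('X_i - 'X_j) * ddm i j m = 'X_[m] - 'X_[swap i j m].
Proof.
move=> ij; have -> : 'X_[m] = 'X_[upd2 i j m (m i) (m j)] :> {mpoly R[n]}.
  by rewrite upd2_id.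
rewrite -upd2_swap /ddm mulrBr.
case: (leqP (m j) (m i)) => [h|/ltnW h]; have /eqP e0 := h.
  by rewrite telescope_upd2 // e0 big_ord0 mulr0 subr0.
by rewrite e0 big_ord0 mulr0 sub0r telescope_upd2 // opprB.
Qed.

Lemma msym_swapX i j m : msym (tperm i j) 'X_[m] = 'X_[swap i j m] :> {mpoly R[n]}.
Proof. by rewrite msymX tpermV. Qed.

Lemma ddE i j f : i != j -> ('X_i - 'X_j) * dd i j f = f - msym (tperm i j) f.
Proof.
move=> ij; rewrite {2}(mpolyE f).
have -> : msym (tperm i j) f = \sum_(m <- msupp f) f@_m *: 'X_[swap i j m].
  rewrite {1}(mpolyE f) (raddf_sum (msym (tperm i j))); apply: eq_bigr => m _.
  by rewrite /= msymZ msym_swapX.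
rewrite -sumrB mulr_sumr; apply: eq_bigr => m _.
by rewrite -scalerAr ddmE // scalerBr.
Qed.

Lemma subX_neq0 i j : i != j -> 'X_i - 'X_j != 0 :> {mpoly R[n]}.
Proof.
move=> ij; apply: contraTneq (oner_neq0 R) => /(congr1 (mcoeff U_(i)%MM)).
by rewrite mcoeffB !mcoeffXU eqxx eq_sym (negbTE ij) subr0 mcoeff0 negbK => /eqP.
Qed.

Lemma heckeE t i j f : i != j ->
  ('X_i - 'X_j) * hecke t i j f =
  (t%:MP * 'X_i - 'X_j) * msym (tperm i j) f - (t - 1)%:MP * 'X_j * f.
Proof.
move=> ij; rewrite /hecke -mul_mpolyC mulrDr [_ * (_ * (f - _))]mulrCA.
rewrite [_ * (f - _)]mulrBr [_ * ('X_i * _)]mulrCA ddE // mpolyCB mpolyC1.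
by ring.
Qed.

Lemma hecke_uniq t i j f g : i != j ->
  ('X_i - 'X_j) * g =
  (t%:MP * 'X_i - 'X_j) * msym (tperm i j) f - (t - 1)%:MP * 'X_j * f ->
  g = hecke t i j f.
Proof. by move=> ij; rewrite -heckeE // => /(mulfI (subX_neq0 ij)). Qed.

Lemma meval_msym (s : 'S_n) f (v : 'I_n -> R) : (msym s f).@[v] = f.@[fun l => v (s l)].
Proof.
rewrite [f]mpolyE (raddf_sum (msym s)) !raddf_sum /=; apply: eq_bigr => m _.
rewrite msymZ !mevalZ msymX !mevalX; congr (_ * _).
by rewrite (reindex_inj (@perm_inj _ s)); apply: eq_bigr => l _; rewrite mnmE permK.
Qed.

Lemma meval_hecke t i j f (v : 'I_n -> R) : i != j ->
  (v i - v j) * (hecke t i j f).@[v] =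
  (t * v i - v j) * f.@[fun l => v (tperm i j l)] - (t - 1) * v j * f.@[v].
Proof.
move=> ij; have := congr1 (meval v) (heckeE t f ij).
by rewrite !(mevalM, mevalB, mevalXU, mevalC, meval_msym).
Qed.

Lemma heckeM t i j e f : i != j -> msym (tperm i j) e = e ->
  hecke t i j (e * f) = e * hecke t i j f.
Proof.
by move=> ij he; apply/esym/hecke_uniq => //; rewrite mulrCA heckeE // msymM he; ring.
Qed.

Lemma heckeZ t i j (c : R) f : i != j -> hecke t i j (c *: f) = c *: hecke t i j f.
Proof. by move=> ij; rewrite -!mul_mpolyC heckeM // /msym mmapC. Qed.

(** With denominators cleared, the eigenvalue equation reads [(t x_i - x_j)(s f - f) = 0], and the
    first factor is nonzero because its coefficient at [x_i] is [t]. *)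
Lemma hecke_eigen_sym t i j f : i != j -> t != 0 -> hecke t i j f = t *: f ->
  msym (tperm i j) f = f.
Proof.
move=> ij t0 h; have := heckeE t f ij; rewrite h -mul_mpolyC mpolyCB mpolyC1.
move=> e; have {e} : (t%:MP * 'X_i - 'X_j) * (msym (tperm i j) f - f) = 0.
  have -> : (t%:MP * 'X_i - 'X_j) * (msym (tperm i j) f - f) =
    (t%:MP * 'X_i - 'X_j) * msym (tperm i j) f - (t%:MP - 1) * 'X_j * f
    - ('X_i - 'X_j) * (t%:MP * f) by ring.
  by rewrite -e subrr.
move/eqP; rewrite mulf_eq0 => /orP[/eqP/(congr1 (mcoeff U_(i)%MM))|].
  rewrite mcoeffB mcoeffCM !mcoeffXU eqxx eq_sym (negbTE ij) mcoeff0 mulr1 subr0.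
  by move=> z; rewrite z eqxx in t0.
by rewrite subr_eq0 => /eqP.
Qed.

(** This is the quadratic relation: the image of [T + 1] lies in the eigenspace for [t], which
    consists of symmetric polynomials. It is checked by clearing denominators. *)
Lemma hecke_add_id_sym t i j f : i != j ->
  msym (tperm i j) (hecke t i j f + f) = hecke t i j f + f.
Proof.
move=> ij; apply: (mulfI (subX_neq0 ij)).
have sXi : msym (tperm i j) 'X_i = 'X_j :> {mpoly R[n]} by rewrite /msym mmapX mmap1U tpermL.
have sXj : msym (tperm i j) 'X_j = 'X_i :> {mpoly R[n]} by rewrite /msym mmapX mmap1U tpermR.
have sC c : msym (tperm i j) c%:MP = c%:MP :> {mpoly R[n]} by rewrite /msym mmapC.
have sK : msym (tperm i j) (msym (tperm i j) f) = f by rewrite -msymMm tperm2 msym1m.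
have := congr1 (msym (tperm i j)) (heckeE t f ij).
rewrite !(msymM, msymB) sXi sXj !sC sK => h.
have -> : ('X_i - 'X_j) * msym (tperm i j) (hecke t i j f + f) =
  - (('X_j - 'X_i) * msym (tperm i j) (hecke t i j f)
     + ('X_j - 'X_i) * msym (tperm i j) f) by rewrite msymD; ring.
by rewrite h mulrDr heckeE // mpolyCB mpolyC1; ring.
Qed.

Lemma msupp_XiM i f m : m \in msupp ('X_i * f) ->
  exists2 m', m' \in msupp f & m = (m' + U_(i))%MM.
Proof.
rewrite mulrC (perm_mem (msuppMX _ _)) => /mapP[m' h ->].
by exists m' => //; rewrite addmC.
Qed.

(** The factor ['X_i] lifts the exponent at [i] strictly above the smaller of the two; this strict
    bound later keeps [swap i j mu] out of the support. *)
Lemma msupp_Xdd i j f m' : i != j -> m' \in msupp ('X_i * dd i j f) ->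
  exists m, [/\ m \in msupp f, between i j m m'
            & (minn (m i) (m j) < m' i)%N].
Proof.
move=> ij /msupp_XiM[m0 h0 ->]; move: h0; rewrite /dd.
move/msupp_sum_le => /flatten_mapP[m]; rewrite filter_predT => hm.
move/msuppZ_le/msuppB_le; rewrite mem_cat => h; exists m.
suff [c [d [-> h1 h2 h3]]] : exists c d, [/\ m0 = upd2 i j m c d,
    (c.+1 + d = m i + m j)%N, (minn (m i) (m j) <= c)%N & (c.+1 <= maxn (m i) (m j))%N].
  have ji : j == i = false by rewrite eq_sym (negbTE ij).
  split=> //; last by rewrite mnmDE mnm1E mnmE !eqxx; lia.
  split; rewrite ?mnmDE ?mnm1E ?mnmE ?eqxx ?ji ?(negbTE ij); [|lia|lia].
  move=> l /negbTE h4 /negbTE h5.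
  by rewrite mnmDE mnm1E mnmE h4 h5 eq_sym h4 addn0.
case/orP: h => /msupp_sum_le/flatten_mapP[l]; rewrite filter_predT => _ /mem_msuppXP <-.
  by exists (m i - l.+1)%N, (m j + l)%N; split=> //; have := ltn_ord l; lia.
by exists (m j - l.+1)%N, (m i + l)%N; split=> //; have := ltn_ord l; lia.
Qed.

Lemma msupp_msym (s : 'S_n) f m : (m \in msupp (msym s f)) = (m#s \in msupp f).
Proof. by rewrite !mcoeff_msupp mcoeff_sym. Qed.

Lemma msupp_hecke t i j f m' : i != j -> m' \in msupp (hecke t i j f) ->
  exists2 m, m \in msupp f & between i j m m'.
Proof.
move=> ij /msuppD_le; rewrite mem_cat => /orP[|/msuppZ_le/msuppB_le].
  rewrite msupp_msym => h; exists (swap i j m') => //.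
  by rewrite -{2}(swapK i j m'); apply: between_swap.
rewrite mem_cat => /orP[h|/(msupp_Xdd ij)[m []]]; last by exists m.
by exists m' => //; apply: between_refl.
Qed.

(** Only [msym (tperm i j) f] reaches the exponent [swap i j mu]. It is not in [f], by [ale_swapF];
    and ['X_i * dd i j f] could produce it only from an [m] with a part above [mu i] at [i] or [j],
    against [ale_off]. *)
Lemma mcoeff_hecke t i j f mu : j = i.+1 :> nat -> (mu j < mu i)%N ->
  (forall m, m \in msupp f -> mdeg m = mdeg mu -> ale m mu) ->
  (hecke t i j f)@_(swap i j mu) = f@_mu.
Proof.
move=> hj lt hf; have ij : i != j by rewrite -val_eqE /=; lia.
have d m : between i j m (swap i j mu) -> mdeg m = mdeg mu.
  by move/(between_mdeg ij); rewrite mdeg_swap.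
rewrite mcoeffD mcoeff_sym -/(swap i j _) swapK mcoeffZ mcoeffB.
rewrite !(@memN_msupp_eq0 _ _ _ (swap i j mu)) ?subrr ?mulr0 ?addr0 //; last first.
- apply/negP=> h; apply: (ale_swapF hj lt); apply: hf => //; exact: mdeg_swap.
- apply/negP=> /(msupp_Xdd ij)[m [hm hb h]].
  have le := hf _ hm (d _ hb).
  case: hb => h1 h2 h3; rewrite swapL swapR in h h2 h3.
  have e l : l != i -> l != j -> m l = mu l.
    by move=> h4 h5; rewrite -h1 // swapE (negbTE h4) (negbTE h5).
  have := ale_off hj lt le e; lia.
Qed.

End Hecke.

Lemma map_mpoly_msym n (R S : nzRingType) (h : {rmorphism R -> S}) (s : 'S_n) (f : {mpoly R[n]}) :
  map_mpoly h (msym s f) = msym s (map_mpoly h f).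
Proof. by apply/mpolyP=> m; rewrite !(mcoeff_map_mpoly, mcoeff_sym). Qed.

Lemma map_mpoly_hecke n (R S : idomainType) (h : {rmorphism R -> S}) t (i j : 'I_n) f :
  i != j -> map_mpoly h (hecke t i j f) = hecke (h t) i j (map_mpoly h f).
Proof.
move=> ij; apply: hecke_uniq => //.
have := congr1 (map_mpoly h) (heckeE t f ij).
rewrite !(rmorphM, rmorphB) /= !map_mpolyX !map_mpolyC map_mpoly_msym => ->.
by congr (_ - (_ - _) * _ * _); congr mpolyC; exact: rmorph1.
Qed.

(** * Interpolation polynomials over a ring of functions of q *)

(* [A] stands for the polynomials in [q] over [K], with the constants [iota] and
   the evaluation [ev] at [q = 1]. *)
Section Existence.
Variables (K : fieldType) (A : idomainType) (t : K) (q : A) (n : nat).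
Variables (iota : {rmorphism K -> A}) (ev : {rmorphism A -> K}).
Hypotheses (t_neq0 : t != 0) (t_inj : injective (fun k : nat => t ^+ k)).
Hypotheses (evK : cancel iota ev) (ev_q : ev q = 1).
Hypothesis q_indep : forall (a : nat) (c d : K),
  q ^+ a.+1 * iota c = iota d -> c = 0.
Implicit Types (m mu nu : 'X_{1..n}) (i j l : 'I_n) (P : {mpoly A[n]}).

Lemma tV_inj (a b : nat) : t ^- a = t ^- b -> a = b.
Proof. by move/invr_inj/t_inj. Qed.

Lemma q_neq0 : q != 0.
Proof. by apply: contraTneq (oner_neq0 K) => e; rewrite -ev_q e rmorph0 eqxx. Qed.

Lemma tV_neq0 (a : nat) : t ^- a != 0.
Proof. by rewrite invr_eq0 expf_neq0. Qed.

(** The spectral point of [nu], with the negative power of [t] formed in [K] because [A] need not be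
    a field. *)
Definition pt nu : 'I_n -> A := fun i => iota (t ^- kstat nu i) * q ^+ nu i.

Lemma ev_pt nu i : ev (pt nu i) = t ^- kstat nu i.
Proof. by rewrite rmorphM rmorphXn /= evK ev_q expr1n mulr1. Qed.

(** Already at [q = 1] the entries are distinct, being powers of [t] with distinct ranks as
    exponents. *)
Lemma pt_neq nu i j : i != j -> pt nu i != pt nu j.
Proof.
apply: contra_neq => /(congr1 ev) /=.
by rewrite !ev_pt => /tV_inj/kstat_inj.
Qed.

(* [P] is a multiple of [E*_mu] whose leading coefficient survives at [q = 1];
   the triangularity condition on the leading monomials is what determines that
   coefficient along the recursion. *)
Definition interpolates mu P : Prop :=
  [/\ forall m, m \in msupp P -> (mdeg m <= mdeg mu)%N,
      forall nu, (mdeg nu <= mdeg mu)%N -> nu != mu -> P.@[pt nu] = 0,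
      P.@[pt mu] != 0,
      forall m, m \in msupp P -> mdeg m = mdeg mu -> ale m mu
    & ev P@_mu != 0].

Lemma interpolates0 : interpolates 0%MM 1.
Proof.
split.
- by move=> m; rewrite msupp1 inE => /eqP->.
- by move=> nu; rewrite mdeg0 leqn0 mdeg_eq0 => ->.
- by rewrite meval1 oner_neq0.
- by move=> m; rewrite msupp1 inE => /eqP-> _.
- by rewrite mcoeff1 eqxx rmorph1 oner_neq0.
Qed.

(** The exchange operator [T_i + c] multiplied by the denominator of [c]. The constant is the one
    that makes the value at [pt mu] vanish. *)
Definition hstep i j mu P : {mpoly A[n]} :=
  (pt mu i - pt mu j) *: hecke (iota t) i j P + ((iota t - 1) * pt mu j) *: P.

Lemma pt_swap nu i j l : j = i.+1 :> nat -> nu i != nu j ->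
  pt (swap i j nu) l = pt nu (tperm i j l).
Proof. by move=> hj hne; rewrite /pt kstat_swap // mnmE. Qed.

Lemma pt_eq_adj nu i j : j = i.+1 :> nat -> nu i = nu j ->
  iota t * pt nu i = pt nu j.
Proof.
move=> hj e; rewrite /pt (kstat_eq_adj hj e) e mulrA -rmorphM exprS.
by rewrite invfM mulVKf.
Qed.

Lemma mcoeff_hstep i j mu P : j = i.+1 :> nat -> (mu j < mu i)%N ->
  (forall m, m \in msupp P -> mdeg m = mdeg mu -> ale m mu) ->
  (hstep i j mu P)@_(swap i j mu) = (pt mu i - pt mu j) * P@_mu.
Proof.
move=> hj lt h4; rewrite mcoeffD !mcoeffZ mcoeff_hecke //.
rewrite (@memN_msupp_eq0 _ _ P (swap i j mu)) ?mulr0 ?addr0 //.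
by apply/negP => h; apply: (ale_swapF hj lt); apply: h4; rewrite ?mdeg_swap.
Qed.

Lemma interpolates_swap i j mu P : j = i.+1 :> nat -> (mu j < mu i)%N ->
  interpolates mu P -> interpolates (swap i j mu) (hstep i j mu P).
Proof.
move=> hj lt [h1 h2 h3 h4 h5].
have ij : i != j by rewrite -val_eqE /=; lia.
have muij : mu i != mu j by lia.
have w_neq : pt mu i - pt mu j != 0 by rewrite subr_eq0 pt_neq.
have hs m : m \in msupp (hstep i j mu P) ->
    exists2 m0, m0 \in msupp P & between i j m0 m.
  move=> /msuppD_le; rewrite mem_cat => /orP[]/msuppZ_le; first exact: msupp_hecke.
  by exists m => //; apply: between_refl.
have evE nu : (pt nu i - pt nu j) * (hstep i j mu P).@[pt nu] =
    (pt mu i - pt mu j) * (iota t * pt nu i - pt nu j) * P.@[fun l => pt nu (tperm i j l)]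
    + (iota t - 1) * (pt mu j * pt nu i - pt nu j * pt mu i) * P.@[pt nu].
  rewrite mevalD !mevalZ mulrDr mulrCA meval_hecke //; ring.
have evs nu : nu i != nu j ->
    P.@[fun l => pt nu (tperm i j l)] = P.@[pt (swap i j nu)].
  by move=> hne; apply: meval_eq => l; rewrite pt_swap.
split.
- move=> m /hs[m0 /h1 h]; move/(between_mdeg ij) => ->.
  by rewrite mdeg_swap.
- move=> nu; rewrite mdeg_swap => hd hne.
  apply/eqP; rewrite -(mulrI_eq0 _ (mulfI (_ : pt nu i - pt nu j != 0))); last first.
    by rewrite subr_eq0 pt_neq.
  apply/eqP; rewrite evE -mulrA.
  (* Equal parts kill the first factor; for unequal parts the swapped point is the spectral point of
     a composition other than [mu]. *)
  have -> : (iota t * pt nu i - pt nu j) * P.@[fun l => pt nu (tperm i j l)] = 0.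
    have [e|hnu] := eqVneq (nu i) (nu j); first by rewrite (pt_eq_adj hj e) subrr mul0r.
    rewrite evs // h2 ?mulr0 ?mdeg_swap //.
    by apply: contraNneq hne => <-; rewrite swapK.
  have [->|hnm] := eqVneq nu mu; last by rewrite h2 // mulr0; ring.
  by ring.
- have hd : swap i j mu != mu.
    by apply: contraNneq muij => /mnmP/(_ i); rewrite swapL => ->.
  apply/eqP => e0; have := evE (swap i j mu).
  rewrite e0 mulr0 evs ?swapL ?swapR 1?eq_sym // swapK (h2 (swap i j mu)) ?mdeg_swap // mulr0 addr0.
  rewrite !pt_swap // tpermL tpermR => /esym/eqP.
  rewrite !mulf_eq0 (negbTE w_neq) (negbTE h3) orbF /=.
  rewrite subr_eq0 => /eqP e; have /eqP := tV_neq0 (kstat mu i); apply.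
  (* The value could only vanish if [t * pt mu j = pt mu i]. Cancelling [q ^+ mu j] leaves a
     positive power of [q] on one side and a constant on the other. *)
  apply: (q_indep (a := mu i - (mu j).+1) (d := t * t ^- kstat mu j)).
  apply: (mulfI (expf_neq0 (mu j) q_neq0)).
  rewrite mulrA -exprD -subSn // subSS subnKC ?(ltnW lt) // mulrC -[LHS]/(pt mu i) -e /pt.
  by rewrite rmorphM; ring.
- move=> m /hs[m0 hm0 hb]; rewrite mdeg_swap => hd.
  apply: (ale_swap hj lt _ hb); apply: h4 => //.
  by rewrite -hd (between_mdeg ij hb).
- rewrite mcoeff_hstep //.
  rewrite rmorphM mulf_neq0 // rmorphB !ev_pt subr_eq0.
  by apply: contra_neq ij => /tV_inj/kstat_inj.
Qed.

(* [q ^ N] times [P (x_2, ..., x_n, x_1 / q)], free of denominators when [N]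
   bounds the degree of [P] *)
Definition rotq (z : 'I_n) N P : {mpoly A[n]} :=
  \sum_(m <- msupp P) (P@_m * q ^+ (N - m (pcyc n z))) *: 'X_[m#(pcyc n)].

Definition phistep (z : 'I_n) N P : {mpoly A[n]} :=
  ('X_z - (iota (t ^- n.-1))%:MP) * rotq z N P.

Lemma mcoeff_rotq z N P m :
  (rotq z N P)@_m = P@_(m#((pcyc n)^-1)%g) * q ^+ (N - m z).
Proof.
have mz : (m#((pcyc n)^-1)%g) (pcyc n z) = m z by rewrite mnmE permK.
rewrite raddf_sum /=.
have zero m' : m' != m#((pcyc n)^-1)%g ->
    ((P@_m' * q ^+ (N - m' (pcyc n z))) *: 'X_[m'#(pcyc n)])@_m = 0.
  move=> h; rewrite mcoeffZ mcoeffX; case: eqP => [e|_]; last by rewrite mulr0.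
  by case/eqP: h; rewrite -e (mpermKV (pcyc n)).
have [hm|hm] := boolP (m#((pcyc n)^-1)%g \in msupp P).
  rewrite (bigD1_seq _ hm) ?msupp_uniq //= big1 ?addr0 => [|m' /zero //].
  by rewrite mcoeffZ mcoeffX mz (mpermK (pcyc n)) eqxx mulr1.
rewrite (memN_msupp_eq0 hm) mul0r big_seq big1 // => m' hm'.
by apply: zero; apply: contraNneq hm => <-.
Qed.

Lemma rotq_q1 z N P :
  map_mpoly (ev) (rotq z N P) =
  msym ((pcyc n)^-1)%g (map_mpoly (ev) P).
Proof.
apply/mpolyP=> m; rewrite mcoeff_map_mpoly mcoeff_rotq mcoeff_sym mcoeff_map_mpoly.
by rewrite /= rmorphM rmorphXn /= ev_q expr1n mulr1.
Qed.

Lemma msupp_rotq z N P m : m \in msupp (rotq z N P) -> 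
  exists2 m', m' \in msupp P & m = m'#(pcyc n).
Proof.
rewrite mcoeff_msupp mcoeff_rotq mulf_eq0 negb_or -mcoeff_msupp => /andP[h _].
by exists (m#((pcyc n)^-1)%g) => //; rewrite (mpermK (pcyc n)).
Qed.

Lemma pt_Phi (z : 'I_n) nu l : z = 0%N :> nat ->
  pt (Phi z nu) l = pt nu (pcyc n l) * q ^+ (z == l).
Proof. by move=> hz; rewrite /pt kstat_Phi // PhiE exprD mulrA. Qed.

Lemma meval_rotq (z : 'I_n) N P nu : z = 0%N :> nat ->
  (forall m, m \in msupp P -> (mdeg m <= N)%N) ->
  (rotq z N P).@[pt (Phi z nu)] = q ^+ N * P.@[pt nu].
Proof.
move=> hz hP; rewrite [P in RHS]mpolyE !raddf_sum /= mulr_sumr big_seq [RHS]big_seq.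
apply: eq_bigr => m /hP hm; rewrite !mevalZ !mevalX.
have le : (m (pcyc n z) <= N)%N.
  by apply: leq_trans hm; rewrite mdegE (bigD1 (pcyc n z)) //= leq_addr.
have -> : \prod_(l < n) pt (Phi z nu) l ^+ (m#(pcyc n)) l =
    \prod_(l < n) pt nu l ^+ m l * q ^+ (m (pcyc n z)) :> A.
  rewrite [X in _ = X * _](reindex_inj (@perm_inj _ (pcyc n))) /=.
  rewrite (eq_bigr (fun l => pt nu (pcyc n l) ^+ m (pcyc n l) * q ^+ ((z == l) * m (pcyc n l)))).
    rewrite big_split /=; congr (_ * _).
    rewrite (bigD1 z) //= eqxx mul1n big1 ?mulr1 // => l /negbTE.
    by rewrite eq_sym => ->; rewrite mul0n expr0.
  by move=> l _; rewrite pt_Phi // mnmE exprMn -exprM.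
have -> : q ^+ N = q ^+ (N - m (pcyc n z)) * q ^+ (m (pcyc n z)) :> A.
  by rewrite -exprD subnK.
ring.
Qed.

Lemma pt_first0 (z : 'I_n) nu : z = 0%N :> nat -> nu z = 0%N ->
  pt nu z = iota (t ^- n.-1).
Proof.
move=> hz h0; rewrite /pt h0 expr0 mulr1 kstat_first0 // => l.
by rewrite hz ltn0.
Qed.

Lemma mcoeff_phistep (z : 'I_n) mu P :
  (forall m, m \in msupp P -> (mdeg m <= mdeg mu)%N) ->
  (phistep z (mdeg mu) P)@_(Phi z mu) = P@_mu * q ^+ (mdeg mu - mu (pcyc n z)).
Proof.
move=> h1; rewrite /phistep mulrBl mul_mpolyC mcoeffB mcoeffZ.
rewrite [(_ * rotq _ _ _)@__](_ : _ = P@_mu * q ^+ (mdeg mu - mu (pcyc n z))); last first.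
  by rewrite (mulrC 'X_z) /Phi addmC mcoeffMX mcoeff_rotq mnmE (mpermKV (pcyc n)).
rewrite (@memN_msupp_eq0 _ _ (rotq _ _ _)) ?mulr0 ?subr0 //.
apply/negP=> /msupp_rotq[m' /h1 hm'] /(congr1 (@mdeg n)).
by rewrite mdeg_Phi mdeg_mperm => e; rewrite -e ltnn in hm'.
Qed.

(** If [nu] begins with zero, the linear factor vanishes at its point; otherwise [nu] is [Phi z nu']
    and the rotated factor reduces to the value of [P] at [pt nu']. *)
Lemma interpolates_Phi (z : 'I_n) mu P : z = 0%N :> nat ->
  interpolates mu P -> interpolates (Phi z mu) (phistep z (mdeg mu) P).
Proof.
move=> hz [h1 h2 h3 h4 h5]; set c := iota (t ^- n.-1).
have hsupp m : m \in msupp (phistep z (mdeg mu) P) ->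
    exists2 m', m' \in msupp P & m = Phi z m' \/ m = m'#(pcyc n).
  rewrite /phistep mulrBl => /msuppB_le; rewrite mem_cat => /orP[/msupp_XiM|].
    by case=> m0 /msupp_rotq[m' hm' ->] ->; exists m' => //; left.
  by rewrite mul_mpolyC => /msuppZ_le/msupp_rotq[m' hm' ->]; exists m' => //; right.
split.
- move=> m /hsupp[m' /h1 hd [->|->]]; rewrite !mdeg_Phi ?ltnS //.
  by rewrite mdeg_mperm ltnW.
- move=> nu; rewrite mdeg_Phi => hd hne; rewrite /phistep mevalM mevalB mevalXU mevalC.
  have [e|/Phi_surj[nu' e]] := eqVneq (nu z) 0%N.
    by rewrite pt_first0 // subrr mul0r.
  rewrite e meval_rotq // h2 ?mulr0 //.
    by move: hd; rewrite e mdeg_Phi.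
  by apply: contra_neq hne => <-.
- rewrite /phistep mevalM mevalB mevalXU mevalC meval_rotq // !mulf_neq0 ?expf_neq0 ?q_neq0 //.
  rewrite subr_eq0 pt_Phi // eqxx -mulrA -exprD addn1 mulrC.
  by apply/eqP=> /q_indep/eqP; apply/negP/tV_neq0.
- move=> m /hsupp[m' hm' [->|->]]; rewrite !mdeg_Phi ?mdeg_mperm.
    by case=> hd; apply: ale_Phi => //; apply: h4.
  by move=> hd; have := h1 _ hm'; rewrite hd ltnn.
- by rewrite mcoeff_phistep // rmorphM rmorphXn /= ev_q expr1n mulr1.
Qed.

Lemma interpolates_ex mu : exists P, interpolates mu P.
Proof.
elim/comp_ind: mu => [|z mu hz [P h]|mu i j hj lt [P h]].
- by exists 1; apply: interpolates0.
- by exists (phistep z (mdeg mu) P); apply: interpolates_Phi.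
- by exists (hstep i j mu P); apply: interpolates_swap.
Qed.

End Existence.

(** * Specialization at q = 1 *)

(* Evaluating the [G mu] at the points [v nu] gives a matrix that is block
   triangular by degree, with an invertible diagonal. *)
Lemma interp_uniq (L : fieldType) n (v : 'X_{1..n} -> 'I_n -> L)
    (G : 'X_{1..n} -> {mpoly L[n]}) :
  (forall mu m, m \in msupp (G mu) -> (mdeg m <= mdeg mu)%N) ->
  (forall mu nu, (mdeg nu <= mdeg mu)%N -> nu != mu -> (G mu).@[v nu] = 0) ->
  (forall mu, (G mu).@[v mu] != 0) ->
  forall d (f : {mpoly L[n]}), (forall m, m \in msupp f -> (mdeg m <= d)%N) ->
    (forall nu, (mdeg nu <= d)%N -> f.@[v nu] = 0) -> f = 0.
Proof.
move=> hdeg hvan hnz d f fdeg fvan.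
pose T : finType := 'X_{1..n < d.+1}; pose ix (k : 'I_#|T|) : 'X_{1..n} := bmnm (enum_val k).
(* [C] holds the coefficients of the [G mu] and [B] the values of the monomials, so [C *m B] holds
   the values of the [G mu]. *)
pose C := \matrix_(k, l) (G (ix k))@_(ix l).
pose B := \matrix_(k, l) \prod_(a < n) v (ix l) a ^+ ix k a.
have ixd k : (mdeg (ix k) <= d)%N by rewrite -ltnS; apply: (valP (enum_val k)).
have evalE (g : {mpoly L[n]}) l : (forall m, m \in msupp g -> (mdeg m <= d)%N) ->
    \sum_k g@_(ix k) * B k l = g.@[v (ix l)].
  move=> hg; have sz : (msize g <= d.+1)%N.
    by rewrite msizeE; apply/bigmax_leqP_seq => m /hg.
  rewrite {2}(mpolywE sz) raddf_sum /=.
  rewrite (reindex (@enum_val _ T)) /=; last first.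
    exists enum_rank => ? _; [exact: enum_valK|exact: enum_rankK].
  by apply: eq_bigr => k _; rewrite mevalZ mevalX mxE.
have CB : C *m B \in unitmx.
  rewrite -row_free_unit -kermx_eq0; apply/rowV0P => u /sub_kermxP hu.
  have CBE k l : (C *m B) k l = (G (ix k)).@[v (ix l)].
    rewrite mxE -evalE; last by move=> m /hdeg h; apply: leq_trans (ixd k).
    by apply: eq_bigr => a _; rewrite mxE.
  apply/rowP => k; rewrite [RHS]mxE.
  (* A kernel vector is zero by induction on degree: in column [k], rows of smaller degree drop out
     by induction, and the other rows off the diagonal have value zero. *)
  have [c] := ubnP (mdeg (ix k)); elim: c k => // c IH k hk.
  have := congr1 (fun w : 'rV_#|T| => w 0 k) hu.
  rewrite /= [in LHS]mxE [RHS]mxE (bigD1 k) //= big1 ?addr0 => [|l hl].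
    by move/eqP; rewrite CBE mulf_eq0 (negbTE (hnz _)) orbF => /eqP.
  rewrite CBE; case: (ltnP (mdeg (ix l)) (mdeg (ix k))) => h.
    by rewrite IH ?mul0r //; apply: leq_trans h _; rewrite -ltnS.
  rewrite hvan ?mulr0 //; apply: contra_neq hl => /val_inj/enum_val_inj; exact.
have Bu : B \in unitmx by move: CB; rewrite unitmx_mul => /andP[].
have f0 : \row_k f@_(ix k) = 0.
  apply: (can_inj (mulmxK Bu)); rewrite mul0mx; apply/rowP => l; rewrite !mxE.
  rewrite -[RHS](fvan (ix l) (ixd l)) -[RHS]evalE //.
  by apply: eq_bigr => k _; rewrite [in LHS]mxE.
apply/mpolyP => m; rewrite mcoeff0.
have [hm|/negPf hm] := boolP (m \in msupp f); last by apply/eqP; rewrite mcoeff_eq0 hm.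
have hd : (mdeg m < d.+1)%N by rewrite ltnS fdeg.
have /rowP/(_ (enum_rank (BMultinom hd : T))) := f0.
by rewrite !mxE /ix enum_rankK.
Qed.

Lemma meval_map n (R S : comNzRingType) (h : {rmorphism R -> S}) (P : {mpoly R[n]}) v :
  (map_mpoly h P).@[fun i => h (v i)] = h P.@[v].
Proof.
rewrite [in LHS](mpolyE P) [in RHS](mpolyE P) (raddf_sum (map_mpoly h)).
rewrite !(raddf_sum (meval _)) (raddf_sum h).
apply: eq_bigr => m _; rewrite /= map_mpolyZ map_mpolyX !mevalZ !mevalX rmorphM rmorph_prod.
by congr (_ * _); apply: eq_bigr => i _; rewrite rmorphXn.
Qed.

Section Specialization.
Variables (K : fieldType) (A : idomainType) (t : K) (q : A) (n : nat).
Variables (iota : {rmorphism K -> A}) (ev : {rmorphism A -> K}).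
Hypotheses (t_neq0 : t != 0) (t_inj : injective (fun k : nat => t ^+ k)).
Hypotheses (evK : cancel iota ev) (ev_q : ev q = 1).
Hypothesis q_indep : forall (a : nat) (c d : K),
  q ^+ a.+1 * iota c = iota d -> c = 0.
Implicit Types (m mu nu : 'X_{1..n}) (i j l : 'I_n) (P Q : {mpoly A[n]}).
Implicit Types (f g : {mpoly K[n]}).

Local Notation interpolates := (interpolates t q iota ev).
Local Notation pt := (pt t q iota).

Let interpolates_ex := interpolates_ex t_neq0 t_inj evK ev_q q_indep (n := n).

(** The constructed polynomials serve as the triangular system over any field containing [A]; both
    the fraction field of [A] and [Q(q,t)] are covered. *)
Lemma interpolates_inj_uniq (L : fieldType) (h : {rmorphism A -> L}) d (E : {mpoly L[n]}) :
  injective h -> (forall m, m \in msupp E -> (mdeg m <= d)%N) ->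
  (forall nu, (mdeg nu <= d)%N -> E.@[fun i => h (pt nu i)] = 0) -> E = 0.
Proof.
move=> hinj; pose G mu := proj1_sig (constructive_indefinite_description _ (interpolates_ex mu)).
have hG mu : interpolates mu (G mu) by rewrite /G; case: constructive_indefinite_description.
apply: (interp_uniq (G := fun mu => map_mpoly h (G mu))) => [mu m|mu nu hd hne|mu].
- rewrite (perm_mem (msupp_map_mpoly _ hinj)); by case: (hG mu) => + _ _ _ _; apply.
- by rewrite meval_map; case: (hG mu) => _ h2 _ _ _; rewrite h2 ?rmorph0.
- rewrite meval_map -(rmorph0 h) (inj_eq hinj); by case: (hG mu).
Qed.

Lemma interpolates_vanish d Q : (forall m, m \in msupp Q -> (mdeg m <= d)%N) ->
  (forall nu, (mdeg nu <= d)%N -> Q.@[pt nu] = 0) -> Q = 0.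
Proof.
move=> hd hv; have hinj : injective (@tofrac A) by move=> a b /eqP; rewrite tofrac_eq => /eqP.
have : map_mpoly (@tofrac A) Q = 0.
  apply: (interpolates_inj_uniq (d := d) hinj) => [m|nu hnu].
    by rewrite (perm_mem (msupp_map_mpoly _ hinj)); apply: hd.
  by rewrite meval_map hv //; exact: rmorph0.
move=> e; apply/mpolyP=> m; apply: hinj.
by rewrite -mcoeff_map_mpoly e !mcoeff0 rmorph0.
Qed.

(** Cross-multiplied by their values at [pt mu], the two polynomials agree at all spectral points up
    to the degree. Proportionality is stated without quotients, which [A] may lack. *)
Lemma interpolates_uniq mu P Q : interpolates mu P -> interpolates mu Q -> P@_mu *: Q = Q@_mu *: P.
Proof.
case=> hP vP zP _ _ [hQ vQ zQ _ _].
have e : P.@[pt mu] *: Q = Q.@[pt mu] *: P.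
  apply/eqP; rewrite -subr_eq0; apply/eqP; apply: (interpolates_vanish (d := mdeg mu)).
    move=> m /msuppB_le; rewrite mem_cat => /orP[]/msuppZ_le; [exact: hQ|exact: hP].
  move=> nu hnu; rewrite mevalB !mevalZ.
  have [->|hne] := eqVneq nu mu; first by rewrite mulrC subrr.
  by rewrite (vP nu) // (vQ nu) // !mulr0 subrr.
have c : P.@[pt mu] * Q@_mu = Q.@[pt mu] * P@_mu by rewrite -!mcoeffZ e.
apply/mpolyP=> m; rewrite !mcoeffZ; apply: (mulfI zP).
rewrite mulrCA -[P.@[_] * Q@_m]mcoeffZ e mcoeffZ mulrCA mulrA -c.
by rewrite mulrA.
Qed.

(* [f] is [E*_mu] at [q = 1]. *)
Definition Estar1 mu f : Prop :=
  exists2 P, interpolates mu P & map_mpoly ev P = ev P@_mu *: f.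

Lemma Estar1_ex mu : exists f, Estar1 mu f.
Proof.
have [P h] := interpolates_ex mu; exists ((ev P@_mu)^-1 *: map_mpoly ev P); exists P => //.
by rewrite scalerA divff ?scale1r //; case: h.
Qed.

Lemma Estar1_uniq mu f g : Estar1 mu f -> Estar1 mu g -> f = g.
Proof.
move=> [P hP eP] [Q hQ eQ]; have := congr1 (map_mpoly ev) (interpolates_uniq hP hQ).
rewrite !map_mpolyZ eP eQ !scalerA mulrC => e.
case: hP hQ => _ _ _ _ zP [_ _ _ _ zQ]; apply/mpolyP=> m.
have := congr1 (mcoeff m) e; rewrite !mcoeffZ; move/(mulfI _) => -> //.
by rewrite mulf_neq0.
Qed.

Lemma Estar1_lead mu f : Estar1 mu f -> f@_mu = 1.
Proof.
move=> [P [_ _ _ _ z] /(congr1 (mcoeff mu))]; rewrite mcoeff_map_mpoly mcoeffZ.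
by rewrite -[X in X = _]mulr1 => /(mulfI z).
Qed.

Lemma Estar1_deg mu f m : Estar1 mu f -> m \in msupp f -> (mdeg m <= mdeg mu)%N.
Proof.
move=> [P [h _ _ _ z] e]; rewrite mcoeff_msupp => hm; apply: h.
rewrite mcoeff_msupp; apply: contraNneq hm => h0.
have := congr1 (mcoeff m) e; rewrite mcoeff_map_mpoly h0 raddf0 mcoeffZ => /esym/eqP.
by rewrite mulf_eq0 (negbTE z).
Qed.

Lemma spec0 : Estar1 0%MM 1.
Proof.
exists 1; first exact: interpolates0.
by rewrite rmorph1 mcoeff1 eqxx rmorph1 scale1r.
Qed.

Lemma Estar1_Phi (z : 'I_n) mu f : z = 0%N :> nat -> Estar1 mu f ->
  Estar1 (Phi z mu) (('X_z - (t ^- n.-1)%:MP) * msym ((pcyc n)^-1)%g f).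
Proof.
move=> hz [P hP eP].
exists (phistep t q iota z (mdeg mu) P); first exact: interpolates_Phi.
have e : map_mpoly ev (phistep t q iota z (mdeg mu) P) =
  ev P@_mu *: (('X_z - (t ^- n.-1)%:MP) * msym ((pcyc n)^-1)%g f).
  rewrite /phistep rmorphM rmorphB /= map_mpolyX map_mpolyC /= evK rotq_q1 // eP msymZ.
  by rewrite scalerAr.
rewrite e mcoeff_phistep; last by case: hP.
by rewrite rmorphM rmorphXn /= ev_q expr1n mulr1.
Qed.

(** At [q = 1] the constant depends on [mu] only through the ranks, so it is unaffected by adding a
    column that respects the ranking. *)
Lemma Estar1_swap i j mu f : j = i.+1 :> nat -> (mu j < mu i)%N -> Estar1 mu f ->
  Estar1 (swap i j mu) (hecke t i j f +
    ((t - 1) * t ^- kstat mu j / (t ^- kstat mu i - t ^- kstat mu j)) *: f).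
Proof.
move=> hj lt [P hP eP]; have ij : i != j by rewrite -val_eqE /=; lia.
exists (hstep t q iota i j mu P); first exact: interpolates_swap.
rewrite mcoeff_hstep //; last by case: hP.
set a := t ^- kstat mu i; set b := t ^- kstat mu j; have nz : a - b != 0.
  by rewrite subr_eq0; apply: contra_neq ij => /(tV_inj t_inj)/kstat_inj.
have e1 : ev (pt mu i - pt mu j) = a - b by rewrite rmorphB !ev_pt.
have e2 : ev ((iota t - 1) * pt mu j) = (t - 1) * b.
  by rewrite rmorphM rmorphB rmorph1 evK ev_pt.
rewrite /hstep rmorphD /= !map_mpolyZ map_mpoly_hecke // eP heckeZ // evK e2 rmorphM e1.
rewrite [RHS]scalerDr !scalerA; congr (_ *: _ + _ *: _); field.
exact: nz.
Qed.

(** [P] is an eigenvector of [hecke] for [t], since the difference vanishes at every spectral point: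
    where [nu i = nu j] by the factor [t x_i - x_j], elsewhere because neither [nu] nor its swap is
    [mu]. *)
Lemma Estar1_eq_sym i j mu f : j = i.+1 :> nat -> mu i = mu j -> Estar1 mu f ->
  msym (tperm i j) f = f.
Proof.
move=> hj e [P hP eP]; have ij : i != j by rewrite -val_eqE /=; lia.
have sP : msym (tperm i j) P = P.
  case: hP => h1 h2 _ _ _.
  apply: (hecke_eigen_sym ij (t := iota t)).
    by apply: contra_neq t_neq0 => h; rewrite -[t]evK h rmorph0.
  apply/eqP; rewrite -subr_eq0; apply/eqP; apply: (interpolates_vanish (d := mdeg mu)).
    move=> m /msuppB_le; rewrite mem_cat.
    by case/orP=> [/(msupp_hecke ij)[m0 h0 /(between_mdeg ij)->]|/msuppZ_le]; apply: h1.
  move=> nu hnu; apply: (mulfI (_ : pt nu i - pt nu j != 0)).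
    by rewrite subr_eq0; apply: pt_neq.
  rewrite mulr0 mevalB mevalZ mulrBr meval_hecke //.
  have -> : forall x y : A, (iota t * pt nu i - pt nu j) * x - (iota t - 1) * pt nu j * y -
     (pt nu i - pt nu j) * (iota t * y) = (iota t * pt nu i - pt nu j) * (x - y).
    by move=> x y; ring.
  have [e'|hne] := eqVneq (nu i) (nu j).
    by rewrite (pt_eq_adj _ _ t_neq0 hj e') subrr mul0r.
  have hnm (nu' : 'X_{1..n}) : nu' i != nu' j -> nu' != mu.
    by apply: contra_neq => ->.
  have -> : P.@[fun l => pt nu (tperm i j l)] = P.@[pt (swap i j nu)].
    by apply: meval_eq => l; rewrite pt_swap.
  rewrite !h2 ?mdeg_swap ?hnm // ?subrr ?mulr0 //.
  by rewrite swapL swapR eq_sym.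
have := congr1 (map_mpoly ev) sP; rewrite map_mpoly_msym eP msymZ => e'.
case: hP => _ _ _ _ z; apply/mpolyP=> m.
by have := congr1 (mcoeff m) e'; rewrite !mcoeffZ => /(mulfI z).
Qed.

End Specialization.

(** * The polynomials e*_k *)

Section ElementarySymmetric.
Variables (K : fieldType) (t : K) (n : nat).
Implicit Types (m mu : 'X_{1..n}) (i j l : 'I_n) (S T : {set 'I_n}).
Implicit Types (f g : {mpoly K[n]}).

Lemma msym_all f :
  (forall i j, j = i.+1 :> nat -> msym (tperm i j) f = f) ->
  forall s : 'S_n, msym s f = f.
Proof.
move=> h; have lt i j : (i < j)%N -> msym (tperm i j) f = f.
  have [k] := ubnP (j - i)%N; elim: k j => // k IH j hk ij.
  have [e|ne] := eqVneq (j : nat) i.+1; first exact: h.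
  have hj : (j.-1 < n)%N by have := ltn_ord j; lia.
  pose j' := Ordinal hj.
  have -> : tperm i j = (tperm i j' ^ tperm j' j)%g.
    rewrite tpermJ tpermL tpermD // -val_eqE /=; lia.
  rewrite conjgE tpermV !msymMm h /=; last by lia.
  by rewrite IH ?h //=; lia.
have any i j : msym (tperm i j) f = f.
  case: (ltngtP i j) => [/lt //|ji|/val_inj->].
    by rewrite tpermC; apply: lt.
  by rewrite tperm1 msym1m.
move=> s; have [ts -> _] := prod_tpermP s; elim: ts => [|x ts IH].
  by rewrite big_nil msym1m.
by rewrite big_cons msymMm any.
Qed.

Definition estar_shift S i : K :=
  t ^+ #|~: S :&: [set l : 'I_n | (l < i)%N]| / t ^+ n.-1.

Definition estar_term S : {mpoly K[n]} :=
  \prod_(i in S) ('X_i - (estar_shift S i)%:MP).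

Lemma estarE k : estar n t k = \sum_(S : {set 'I_n} | #|S| == k) estar_term S.
Proof. by []. Qed.

Lemma msymU (s : 'S_n) i : msym s 'X_i = 'X_(s i) :> {mpoly K[n]}.
Proof. by rewrite /msym mmapX mmap1U. Qed.

Lemma msymC (s : 'S_n) (c : K) : msym s c%:MP = c%:MP :> {mpoly K[n]}.
Proof. by rewrite /msym mmapC. Qed.

Lemma in_tperm_imset i j S l : (l \in tperm i j @: S) = (tperm i j l \in S).
Proof.
apply/imsetP/idP => [[l' h ->]|h]; first by rewrite tpermK.
by exists (tperm i j l) => //; rewrite tpermK.
Qed.

(** The positions left of [l] contain both or neither of the neighbours [i], [j] unless [l = j]. *)
Lemma estar_shift_tperm i j S l : j = i.+1 :> nat -> l != j ->
  estar_shift (tperm i j @: S) l = estar_shift S l.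
Proof.
move=> hj lj; congr (_ ^+ _ / _).
rewrite -(card_imset _ (@perm_inj _ (tperm i j))).
apply: eq_card => a; rewrite in_tperm_imset !inE in_tperm_imset tpermK.
congr (_ && _); move: lj.
case: (tpermP i j a) => [->|->|/eqP + /eqP +]; rewrite -?val_eqE /=; lia.
Qed.

Lemma estar_term_split i j S : i != j -> estar_term S =
  (if i \in S then 'X_i - (estar_shift S i)%:MP else 1) *
  ((if j \in S then 'X_j - (estar_shift S j)%:MP else 1) *
   \prod_(l in S | (l != i) && (l != j)) ('X_l - (estar_shift S l)%:MP)).
Proof.
move=> ij; rewrite /estar_term big_mkcond (bigD1 i) //= (bigD1 j) ?(eq_sym j) //=.
congr (_ * (_ * _)); rewrite [RHS]big_mkcondl; apply: eq_bigl => l.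
by [].
Qed.

(** Terms containing both or neither of [i], [j] are invariant, the two shifts being equal in the
    first case. In the others the shift cancels from the difference [D S], and [S] cancels against
    its image under the transposition. *)
Lemma estar_adj_sym k i j : j = i.+1 :> nat ->
  msym (tperm i j) (estar n t k) = estar n t k.
Proof.
move=> hj; have ij : i != j by rewrite -val_eqE /=; lia.
have ji : j != i by rewrite eq_sym.
pose s := tperm i j; rewrite estarE (raddf_sum (msym s)) /=.
pose rest S : {mpoly K[n]} :=
  \prod_(l in S | (l != i) && (l != j)) ('X_l - (estar_shift S l)%:MP).
have rest_s S : msym s (rest S) = rest S.
  rewrite /rest (rmorph_prod (msym s)); apply: eq_bigr => l /and3P[_ h1 h2] /=.
  by rewrite msymB msymU msymC tpermD // eq_sym.
have restsS S : rest (s @: S) = rest S.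
  apply: eq_big => l.
    rewrite in_tperm_imset; case: eqVneq => [->|h1]; first by rewrite !andbF.
    case: eqVneq => [->|h2]; first by rewrite !andbF.
    by rewrite tpermD // eq_sym.
  by case/and3P=> _ h1 h2; rewrite estar_shift_tperm.
pose D S := msym s (estar_term S) - estar_term S.
have DE S : D S = if (i \in S) == (j \in S) then 0 else
    if i \in S then rest S * ('X_j - 'X_i) else rest S * ('X_i - 'X_j).
  rewrite /D (estar_term_split _ ij) -/(rest S) !msymM rest_s.
  rewrite !(fun_if (msym s)) !msymB !msymU !msymC mpolyC1 tpermL tpermR.
  have shj : i \in S -> estar_shift S j = estar_shift S i.
    move=> hi; congr (_ ^+ _ / _); apply: eq_card => l; rewrite !inE.
    have [->|hl] := eqVneq l i; first by rewrite hi ltnn !andbF.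
    by congr (_ && _); move: hl; rewrite -val_eqE /=; lia.
  case hi: (i \in S); case hj': (j \in S) => /=.
  - by rewrite shj //; ring.
  - by ring.
  - by ring.
  - by ring.
apply/eqP; rewrite -subr_eq0 -sumrB; apply/eqP.
rewrite (eq_bigr D) // (bigID (fun S => (i \in S) == (j \in S))) /=.
rewrite big1 ?add0r => [|S /andP[_ h]]; last by rewrite DE h.
rewrite (bigID (fun S : {set 'I_n} => i \in S)) /=.
rewrite [X in _ + X](reindex_inj (imset_inj (@perm_inj _ s))) /=.
rewrite -[RHS](subrr
  (\sum_(S : {set 'I_n} | [&& #|S| == k, (i \in S) != (j \in S) & i \in S]) D S)) -sumrN.
congr (_ + _); first by apply: eq_bigl => S; rewrite andbA.
apply: eq_big => S; rewrite (card_imset _ (@perm_inj _ s)) !in_tperm_imset tpermL tpermR.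
  by case: (i \in S); case: (j \in S); rewrite ?andbF ?andbT.
case/andP=> /andP[_ h1] h2.
rewrite !DE !in_tperm_imset tpermL tpermR restsS.
by move: h1 h2; case: (i \in S); case: (j \in S) => //= _ _; ring.
Qed.

Lemma estar_sym k (s : 'S_n) : msym s (estar n t k) = estar n t k.
Proof. by apply: msym_all => i j; apply: estar_adj_sym. Qed.

Lemma msupp_prod_XsubC (r : seq 'I_n) (c : 'I_n -> K) m l : uniq r ->
  m \in msupp (\prod_(a <- r) ('X_a - (c a)%:MP) : {mpoly K[n]}) ->
  (m l <= (l \in r))%N.
Proof.
elim: r m => [|x r IH] m /=; first by rewrite big_nil msupp1 inE => _ /eqP->; rewrite mnm0E.
case/andP=> xr ur; rewrite big_cons mulrBl => /msuppB_le; rewrite mem_cat inE.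
case/orP=> [/msupp_XiM[m' /(IH _ ur) h ->]|].
  rewrite mnmDE mnm1E (eq_sym x); case: (eqVneq l x) h => [->|_] h /=; last by rewrite addn0.
  by move: h; rewrite (negbTE xr); lia.
by rewrite mul_mpolyC => /msuppZ_le/(IH _ ur); case: (l == x) => //=; case: (l \in r); lia.
Qed.

Lemma mcoeff_prod_XsubC (r : seq 'I_n) (c : 'I_n -> K) m : uniq r ->
  (forall l, m l = (l \in r)) ->
  (\prod_(a <- r) ('X_a - (c a)%:MP) : {mpoly K[n]})@_m = 1.
Proof.
elim: r m => [|x r IH] m /=.
  by move=> _ h; rewrite big_nil mcoeff1 (_ : m = 0%MM) ?eqxx //; apply/mnmP=> l; rewrite h mnm0E.
case/andP=> xr ur hm; rewrite big_cons mulrBl mcoeffB mul_mpolyC mcoeffZ.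
have -> : m = ((m - U_(x)) + U_(x))%MM.
  apply/mnmP=> l; rewrite mnmDE mnmBE mnm1E hm inE (eq_sym x); case: (eqVneq l x) => /=; lia.
rewrite mulrC addmC mcoeffMX IH // ?[X in c x * X]memN_msupp_eq0 ?mulr0 ?subr0 //.
  apply/negP=> /(msupp_prod_XsubC x ur); rewrite (negbTE xr) mnmDE mnm1E eqxx; lia.
move=> l; rewrite mnmBE mnm1E hm inE (eq_sym x); case: (eqVneq l x) => [->|_] /=.
  by rewrite (negbTE xr).
by rewrite subn0.
Qed.

Lemma msupp_estar k m : m \in msupp (estar n t k) ->
  (forall l, (m l <= 1)%N) /\ (mdeg m <= k)%N.
Proof.
rewrite estarE => /msupp_sum_le/flatten_mapP[S]; rewrite mem_filter => /andP[/eqP hS _].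
rewrite /estar_term -big_enum => h.
have {}h l : (m l <= (l \in S))%N.
  by rewrite -mem_enum; apply: (msupp_prod_XsubC _ (enum_uniq _) h).
split=> [l|]; first by apply: leq_trans (h l) _; case: (l \in S).
by rewrite -hS -sum1_card big_mkcond mdegE; apply: leq_sum => l _; have := h l; case: ifP.
Qed.

Lemma mcoeff_estar T : (estar n t #|T|)@_(mesym1 T) = 1.
Proof.
rewrite estarE raddf_sum (bigD1 T) //= big1 ?addr0 => [|S /andP[/eqP hS hne]].
  rewrite /estar_term -big_enum mcoeff_prod_XsubC ?enum_uniq // => l.
  by rewrite mnmE mem_enum.
apply: memN_msupp_eq0; apply: contraNN hne; rewrite /estar_term -big_enum => h.
rewrite eq_sym eqEcard hS leqnn andbT; apply/subsetP => l hl.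
have := msupp_prod_XsubC l (enum_uniq _) h; rewrite mnmE hl mem_enum.
by case: (l \in S).
Qed.

End ElementarySymmetric.

(** * E*_mu at q = 1 for antidominant 0-1 compositions *)

Section ZeroOne.
Variable n : nat.
Implicit Types (mu : 'X_{1..n}) (k r : nat).

Definition iset k : {set 'I_n} := [set l : 'I_n | (l < k)%N].

Lemma card_iset k : (k <= n)%N -> #|iset k| = k.
Proof.
move=> kn; have -> : iset k = [set widen_ord kn a | a in [set: 'I_k]].
  apply/setP=> l; rewrite inE; apply/idP/imsetP => [h|[a _ ->]]; last exact: (ltn_ord a).
  by exists (Ordinal h) => //; apply: val_inj.
by rewrite card_imset ?cardsT ?card_ord // => a b /(congr1 val)/= /val_inj.
Qed.

Lemma mdeg01 mu : (forall l, (mu l <= 1)%N) -> mu = mesym1 [set l | mu l == 1%N].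
Proof. by move=> h; apply/mnmP=> l; rewrite mnmE inE; have := h l; case: eqP; lia. Qed.

Lemma decreasing01 mu : (forall l, (mu l <= 1)%N) ->
  (forall i j : 'I_n, (i <= j)%N -> (mu j <= mu i)%N) -> mu = mesym1 (iset (mdeg mu)).
Proof.
move=> h dec; pose S := [set l | mu l == 1%N].
have e : mu = mesym1 S by apply: mdeg01.
rewrite {1}e; congr mesym1; apply/setP=> l; rewrite [RHS]inE e mdeg_mesym1.
have [hl|hl] := boolP (l \in S); apply/esym.
  rewrite -(card_iset (ltn_ord l)); apply: subset_leq_card; apply/subsetP=> a.
  rewrite !inE ltnS in hl * => /dec; move/eqP: hl => ->; have := h a; lia.
apply/negbTE; rewrite -leqNgt -(card_iset (ltnW (ltn_ord l))).
apply: subset_leq_card; apply/subsetP=> a; rewrite !inE in hl * => /eqP ha.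
rewrite ltnNge; apply: contraNN hl => /dec; have := h l; lia.
Qed.

End ZeroOne.

Section Base.
Variables (K : fieldType) (A : idomainType) (t : K) (q : A) (n : nat).
Variables (iota : {rmorphism K -> A}) (ev : {rmorphism A -> K}).
Hypotheses (t_neq0 : t != 0) (t_inj : injective (fun k : nat => t ^+ k)).
Hypotheses (evK : cancel iota ev) (ev_q : ev q = 1).
Hypothesis q_indep : forall (a : nat) (c d : K),
  q ^+ a.+1 * iota c = iota d -> c = 0.
Hypothesis mesym_geom_neq0 : forall k, (k <= n)%N ->
  (mesym n K k).@[fun l : 'I_n => t ^+ l] != 0.
Implicit Types (m mu nu : 'X_{1..n}) (i j l : 'I_n) (f g : {mpoly K[n]}).

Local Notation Estar1 := (Estar1 t q iota ev).

Let c0 : K := t ^- n.-1.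

(** The composition arises from zero by applying [Phi] [k] times, and each application contributes
    one linear factor. *)
Lemma Estar1_iset k : (k <= n)%N ->
  Estar1 (mesym1 (iset n k)) (\prod_(l < n | (l < k)%N) ('X_l - c0%:MP)).
Proof.
elim: k => [_|k IH hk].
  rewrite big_pred0 // (_ : mesym1 _ = 0%MM); first exact: spec0.
  by apply/mnmP=> l; rewrite mnmE inE mnm0E.
have n0 : (0 < n)%N by lia.
pose z := Ordinal n0; have hz : z = 0%N :> nat by [].
have lz l : (z == l) = (l == 0%N :> nat) by rewrite -val_eqE /= eq_sym.
have -> : mesym1 (iset n k.+1) = Phi z (mesym1 (iset n k)).
  apply/mnmP=> l; rewrite PhiE !mnmE !inE lz pcycE.
  by have := ltn_ord l; case: (posnP l) => h; rewrite ?h; lia.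
have -> : \prod_(l < n | (l < k.+1)%N) ('X_l - c0%:MP) = ('X_z - c0%:MP) *
    msym ((pcyc n)^-1)%g (\prod_(l < n | (l < k)%N) ('X_l - c0%:MP)) :> {mpoly K[n]}.
  rewrite (bigD1 z) //=; congr (_ * _).
  rewrite (rmorph_prod (msym ((pcyc n)^-1)%g)) [RHS](reindex_inj (@perm_inj _ (pcyc n))) /=.
  apply: eq_big => l; last by rewrite msymB msymU msymC permK.
  rewrite pcycE eq_sym lz; have := ltn_ord l.
  by case: (posnP l) => h; rewrite ?h; lia.
by apply: Estar1_Phi => //; apply: IH; apply: ltnW.
Qed.

(* A geometric progression of ratio [t], on which the operators [hecke] act as
   the scalar [t]. *)
Definition zpt (r : nat) : 'I_n -> K := fun l => t ^- (n.-1 + r) * t ^+ l.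

Lemma Estar1_01 mu : (forall l, (mu l <= 1)%N) ->
  exists f, [/\ Estar1 mu f, forall m, m \in msupp f -> forall l, (m l <= 1)%N
    & forall r, (r < mdeg mu)%N -> f.@[zpt r] = 0].
Proof.
move: mu; apply: (bubble_ind (P := fun mu => (forall l, (mu l <= 1)%N) -> _)).
  move=> mu dec h; set k := mdeg mu.
  have hk : (k <= n)%N.
    rewrite /k (mdeg01 h) mdeg_mesym1; apply: leq_trans (max_card _) _.
    by rewrite card_ord.
  exists (\prod_(l < n | (l < k)%N) ('X_l - c0%:MP)); split.
  - by rewrite {1}(decreasing01 h dec); apply: Estar1_iset.
  - move=> m; rewrite -big_filter => hm l.
    have := msupp_prod_XsubC l (filter_uniq _ (index_enum_uniq _)) hm.
    by case: (l \in _); lia.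
  - move=> r hr; have rn : (r < n)%N by apply: leq_trans hk.
    (* The progression [zpt r] takes the value [t ^- n.-1] at position [r], so that factor
       vanishes. *)
    rewrite (bigD1 (Ordinal rn)) //= mevalM mevalB mevalXU mevalC /zpt /=.
    by rewrite exprD invfM mulfVK ?expf_neq0 // subrr mul0r.
move=> mu i j hj lt IH h; have ij : i != j by rewrite -val_eqE /=; lia.
case: IH => [l|f [h1 h2 h3]].
  by have := h (tperm i j l); rewrite mnmE tpermK.
have := Estar1_swap t_neq0 t_inj evK ev_q q_indep hj lt h1; set c := _ / _ => hs.
exists (hecke t i j f + c *: f); split=> //.
- move=> m /msuppD_le; rewrite mem_cat.
  case/orP=> [/(msupp_hecke ij)[m0 /h2 hm0 [b1 b2 b3]] l|/msuppZ_le/h2 //].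
  have [->|li] := eqVneq l i; first by have := hm0 i; have := hm0 j; lia.
  have [->|lj] := eqVneq l j; first by have := hm0 i; have := hm0 j; lia.
  by rewrite b1.
- move=> r; rewrite mdeg_swap => hr; rewrite mevalD mevalZ h3 // mulr0 addr0.
  have nz : zpt r i - zpt r j != 0.
    rewrite -mulrBr mulf_neq0 ?invr_eq0 ?expf_neq0 // subr_eq0.
    by apply/eqP=> /t_inj; rewrite hj; lia.
  apply: (mulfI nz); rewrite meval_hecke // h3 // !mulr0 subr0.
  by rewrite /zpt hj exprS mulrCA subrr mul0r.
Qed.

(** Each term vanishes: as [r < #|S|], some [l] in [S] has exactly [r] members of [S] to its left,
    hence [l - r] non-members, and its shift is the coordinate of [zpt r] at [l]. *)
Lemma estar_zpt k r : (r < k)%N -> (estar n t k).@[zpt r] = 0.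
Proof.
move=> rk; rewrite estarE raddf_sum big1 // => S /eqP hS.
have [l hl hc] : exists2 l, l \in S & #|S :&: iset n l| = r.
  have n0 : (0 < n)%N.
    by case: (posnP n) => // e; have := max_card (mem S); rewrite hS card_ord; lia.
  have ex : exists p, (r < #|S :&: iset n p.+1|)%N.
    exists n; rewrite (_ : S :&: _ = S) ?hS //; apply/setIidPl/subsetP=> l _.
    by rewrite inE ltnS ltnW.
  case: (ex_minnP ex) => p hp hmin.
  have le : (#|S :&: iset n p| <= r)%N.
    case: p hp hmin => [|p] _ hmin.
      by rewrite (_ : iset n 0%N = set0) ?setI0 ?cards0 //; apply/setP=> l; rewrite !inE.
    by rewrite leqNgt; apply/negP=> /hmin; rewrite ltnn.
  have pn : (p < n)%N.
    rewrite ltnNge; apply/negP=> np; have : S :&: iset n p.+1 = S :&: iset n p.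
      by congr (_ :&: _); apply/setP=> l; rewrite !inE; have := ltn_ord l; lia.
    by move=> e; move: hp; rewrite e; lia.
  pose l := Ordinal pn.
  have sub : S :&: iset n p.+1 = if l \in S then l |: (S :&: iset n p) else S :&: iset n p.
    apply/setP=> a; rewrite !inE ltnS leq_eqVlt -[(a == p :> nat)]/(a == l).
    have [->|ne] /= := eqVneq a l; case hl: (l \in S); rewrite !inE ?eqxx ?hl ?(negbTE ne) //.
  move: hp; rewrite sub; case: ifP => [hl|_]; last by lia.
  rewrite cardsU1 !inE ltnn andbF /= add1n ltnS => hp; exists l => //.
  by apply/eqP; rewrite eqn_leq le.
rewrite /= /estar_term (rmorph_prod (meval _)) (bigD1 l) //= mevalB mevalXU mevalC.
have e : #|~: S :&: [set a : 'I_n | (a < l)%N]| = (l - r)%N.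
  rewrite -hc -[in LHS]/(iset n l) setIC -setDE cardsD card_iset 1?ltnW //.
  by rewrite setIC.
have rl : (r <= l)%N.
  rewrite -hc -{2}(card_iset (ltnW (ltn_ord l))); apply: subset_leq_card.
  exact: subsetIr.
rewrite /estar_shift e /zpt -{1}(subnK rl) !exprD invfM.
set x := t ^+ (l - r); set y := t ^+ r; set w := t ^+ n.-1.
have y0 : y != 0 by apply: expf_neq0.
rewrite (_ : w^-1 / y * (x * y) - x / w = 0) ?mul0r //.
by rewrite mulrAC -mulrA [x * y * _]mulfK // mulrC subrr.
Qed.

(* Such a [g] is a combination of the elementary symmetric polynomials of degree
   less than [k], hence restricts to a polynomial of degree less than [k] in the
   scale of a geometric progression, where it has [k] zeros. *)
Lemma symmetric01_eq0 k g : (k <= n)%N ->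
  (forall i j, j = i.+1 :> nat -> msym (tperm i j) g = g) ->
  (forall m, m \in msupp g -> forall l, (m l <= 1)%N) ->
  (forall m, m \in msupp g -> (mdeg m <= k)%N) ->
  (exists2 m, mdeg m = k & (forall l, (m l <= 1)%N) /\ g@_m = 0) ->
  (forall r, (r < k)%N -> g.@[zpt r] = 0) -> g = 0.
Proof.
move=> kn hsym h01 hdeg [m0 hm0 [h0 h0g]] hz.
pose a k' := g@_(mesym1 (iset n k')).
have ga mu : (forall l, (mu l <= 1)%N) -> g@_mu = a (mdeg mu).
  move: mu; apply: (bubble_ind (P := fun mu => (forall l, (mu l <= 1)%N) -> _)).
    by move=> mu dec h; rewrite {1}(decreasing01 h dec).
  move=> mu i j hj lt IH h; rewrite mdeg_swap -IH.
    by rewrite -[in RHS](hsym i j hj) mcoeff_sym.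
  by move=> l; have := h (tperm i j l); rewrite mnmE tpermK.
have ak : a k = 0 by rewrite -hm0 -ga.
have gE : g = \sum_(k' < k) a k' *: mesym n K k'.
  apply/mpolyP=> m; rewrite raddf_sum /=.
  under eq_bigr => k' _ do rewrite mcoeffZ mcoeff_mesym /mechar.
  have [hm|] := boolP [forall i, (m i <= 1)%N]; last first.
    move=> hm; rewrite big1 => [|k' _]; last by rewrite andbF mulr0.
    by apply: memN_msupp_eq0; apply: contraNN hm => /h01 h; apply/forallP.
  rewrite ga; last by move/forallP: hm.
  case: (ltngtP (mdeg m) k) => [lt|gt|->].
  - rewrite (bigD1 (Ordinal lt)) //= eqxx mulr1 big1 ?addr0 // => k' /eqP hk'.
    by case: eqP => [e|_]; [case: hk'; apply: val_inj|rewrite mulr0].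
  - rewrite big1 => [|k' _]; last by case: eqP => [e|_]; rewrite ?mulr0 //; have := ltn_ord k'; lia.
    rewrite -ga; last by move/forallP: hm.
    by apply: memN_msupp_eq0; apply/negP=> /hdeg; lia.
  - rewrite ak big1 // => k' _; case: eqP => [e|_]; rewrite ?mulr0 //.
    by have := ltn_ord k'; lia.
pose y : 'I_n -> K := fun l => t ^+ l.
have zE r : g.@[zpt r] = (\poly_(k' < k) (a k' * (mesym n K k').@[y])).[t ^- (n.-1 + r)].
  rewrite horner_poly gE raddf_sum /=; apply: eq_bigr => k' _; rewrite mevalZ -mulrA; congr (_ * _).
  rewrite mesymE !raddf_sum mulr_suml; apply: eq_bigr => S /eqP hS /=.
  rewrite !mevalX /zpt -hS -mdeg_mesym1 mdegE -prodrXr -big_split /=.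
  by apply: eq_bigr => l _; rewrite exprMn mulrC.
have p0 : \poly_(k' < k) (a k' * (mesym n K k').@[y]) = 0.
  apply: (roots_geq_poly_eq0 (rs := [seq t ^- (n.-1 + r) | r <- seq.iota 0 k])).
  - by apply/allP=> x /mapP[r]; rewrite mem_iota => /andP[_ hr] ->; rewrite rootE -zE hz.
  - rewrite map_inj_uniq ?iota_uniq // => r1 r2 /(tV_inj t_inj); lia.
  - by rewrite size_map size_iota size_poly.
rewrite gE big1 // => k' _; have := congr1 (fun p : {poly K} => p`_k') p0.
have kn' : (k' <= n)%N by have := ltn_ord k'; lia.
rewrite coef_poly ltn_ord coef0 => /eqP.
rewrite mulf_eq0 (negbTE (mesym_geom_neq0 kn')) orbF => /eqP->.
by rewrite scale0r.
Qed.

(** Both polynomials are symmetric with exponents at most one, have leading coefficient 1 and vanish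
    at [zpt r] for [r < k], so [symmetric01_eq0] kills their difference. *)
Lemma Estar1_antidominant01 k : (k <= n)%N ->
  Estar1 (mesym1 [set l : 'I_n | (n - k <= l)%N]) (estar n t k).
Proof.
move=> kn; set mu := mesym1 _.
have muE l : mu l = (n - k <= l)%N :> nat by rewrite /mu mnmE inE.
have mu1 l : (mu l <= 1)%N by rewrite muE leq_b1.
have dmu : mdeg mu = k.
  rewrite mdeg_mesym1 (_ : [set l | _] = ~: iset n (n - k)); last first.
    by apply/setP=> l; rewrite !inE -leqNgt.
  by rewrite cardsCs setCK card_iset ?card_ord ?leq_subr //; lia.
have [f [hf f01 fz]] := Estar1_01 mu1.
suff e : f - estar n t k = 0.
  by have /eqP := e; rewrite subr_eq0 => /eqP <-.
apply: (symmetric01_eq0 kn).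
- move=> i j hj; have ij : i != j by rewrite -val_eqE /=; lia.
  rewrite msymB estar_adj_sym //; congr (_ - _).
  have [e|ne] := eqVneq (mu i) (mu j); first exact: (Estar1_eq_sym _ _ _ _ _ hj e hf).
  have lt : (mu i < mu j)%N.
    by rewrite ltn_neqAle ne !muE hj; case: (leqP (n - k) i) => h //=; rewrite (leq_trans h).
  pose nu := swap i j mu.
  have lt' : (nu j < nu i)%N by rewrite swapL swapR.
  have [g hg] := Estar1_ex t_neq0 t_inj evK ev_q q_indep nu.
  have := Estar1_swap t_neq0 t_inj evK ev_q q_indep hj lt' hg.
  (* In [nu] position [i] holds the leftmost one and [j] the rightmost zero. They are consecutive in
     the ranking, which makes the constant of the exchange equal to 1. *)
  rewrite swapK; have -> : kstat nu j = (kstat nu i).+1.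
    rewrite !kstatE (_ : [set l | beats nu l j] = i |: [set l | beats nu l i]).
      by rewrite cardsU1 inE beats_irr.
    apply/setP=> l; rewrite !inE /beats swapL swapR.
    have [->|li] := eqVneq l i; first by rewrite swapL lt.
    have [->|lj] := eqVneq l j; first by rewrite swapR eqxx ltnn /=; lia.
    rewrite swapE (negbTE li) (negbTE lj); move: li lj lt.
    rewrite !muE -!val_eqE /= hj; lia.
  set x := t ^+ kstat nu i; have x0 : x != 0 by apply: expf_neq0.
  have t1 : t - 1 != 0.
    by rewrite subr_eq0 -{1}[t]expr1 -(expr0 t); apply/eqP=> /t_inj.
  have -> : (t - 1) * t ^- (kstat nu i).+1 / (t ^- kstat nu i - t ^- (kstat nu i).+1) = 1.
    rewrite exprS -/x; have -> : x^-1 - (t * x)^-1 = (t - 1) * (t * x)^-1.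
      by field; rewrite x0 t_neq0.
    by rewrite divff // mulf_neq0 ?invr_eq0 ?mulf_neq0.
  rewrite scale1r => hs; have -> := Estar1_uniq t_neq0 t_inj evK ev_q q_indep hf hs.
  exact: hecke_add_id_sym.
- by move=> m /msuppB_le; rewrite mem_cat => /orP[/f01|/msupp_estar[]].
- move=> m /msuppB_le; rewrite mem_cat => /orP[/(Estar1_deg hf)|/msupp_estar[] //].
  by rewrite dmu.
- exists mu => //; split=> //; rewrite mcoeffB (Estar1_lead hf) -dmu /mu mdeg_mesym1 mcoeff_estar.
  by rewrite subrr.
- by move=> r hr; rewrite mevalB fz ?dmu // estar_zpt // subrr.
Qed.

End Base.

(** * Adding a column *)

Lemma beatsD n (mu rho : 'X_{1..n}) :
  (forall a b, beats mu a b -> (rho b <= rho a)%N) ->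
  beats (mu + rho)%MM =2 beats mu.
Proof.
move=> h a b; rewrite {1}/beats !mnmDE.
have [->|ab] := eqVneq a b; first by rewrite beats_irr !ltnn andbF.
have := beats_total mu ab; have := h a b; have := h b a; rewrite /beats; lia.
Qed.

Lemma kstatD n (mu rho : 'X_{1..n}) i :
  (forall a b, beats mu a b -> (rho b <= rho a)%N) ->
  kstat (mu + rho)%MM i = kstat mu i.
Proof. by move=> /beatsD h; rewrite !kstatE; apply: eq_card => l; rewrite !inE h. Qed.

Section Columns.
Variables (K : fieldType) (A : idomainType) (t : K) (q : A) (n : nat).
Variables (iota : {rmorphism K -> A}) (ev : {rmorphism A -> K}).
Hypotheses (t_neq0 : t != 0) (t_inj : injective (fun k : nat => t ^+ k)).
Hypotheses (evK : cancel iota ev) (ev_q : ev q = 1).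
Hypothesis q_indep : forall (a : nat) (c d : K),
  q ^+ a.+1 * iota c = iota d -> c = 0.
Hypothesis mesym_geom_neq0 : forall k, (k <= n)%N ->
  (mesym n K k).@[fun l : 'I_n => t ^+ l] != 0.
Implicit Types (m mu nu eta : 'X_{1..n}) (i j l a b : 'I_n) (f g : {mpoly K[n]}).
Implicit Types (T : {set 'I_n}).

Local Notation Estar1 := (Estar1 t q iota ev).
Let Estar1_ex := Estar1_ex t_neq0 t_inj evK ev_q q_indep (n := n).
Let Estar1_uniq := Estar1_uniq t_neq0 t_inj evK ev_q q_indep (n := n).

(** For the zero composition the ranking runs from right to left, so its initial segments are the
    final segments of positions. *)
Lemma upward_closed0 T : (forall a b, b \in T -> beats 0%MM a b -> a \in T) ->
  T = [set l : 'I_n | (n - #|T| <= l)%N].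
Proof.
move=> up; have upT a b : b \in T -> (b <= a)%N -> a \in T.
  rewrite leq_eqVlt => hb /orP[/eqP/val_inj<- //|lt].
  by apply: up hb _; rewrite /beats !mnm0E eqxx.
apply/setP=> l; rewrite inE.
have cT := cardsC (iset n l); rewrite card_iset ?card_ord in cT; last exact: ltnW.
have cT' := cardsC (iset n l.+1); rewrite card_iset ?card_ord in cT'; last exact: ltn_ord.
have [hl|hl] := boolP (l \in T); apply/esym.
  have : (#|~: iset n l| <= #|T|)%N.
    by apply/subset_leq_card/subsetP=> a; rewrite !inE -leqNgt; apply: upT.
  by lia.
apply/negbTE; rewrite -ltnNge.
have : (#|T| <= #|~: iset n l.+1|)%N.
  apply/subset_leq_card/subsetP=> a ha; rewrite !inE ltnS -ltnNge.
  by rewrite ltnNge; apply: contraNN hl; apply: upT.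
have := ltn_ord l; lia.
Qed.

(** [T] is transported along the permutation of each recursion step to a segment [T'] for the
    smaller composition. The constants agree by [kstatD], and the symmetric factor [estar] passes
    through both operators. *)
Lemma Estar1_column mu T f : (forall a b, b \in T -> beats mu a b -> a \in T) ->
  Estar1 mu f -> Estar1 (mu + mesym1 T)%MM (estar n t #|T| * f).
Proof.
elim/comp_ind: mu T f => [|z mu hz IH|mu i j hj lt IH] T f up hf.
- rewrite add0m (Estar1_uniq hf (spec0 _ _ _ _ _)) // mulr1.
  rewrite {1}(upward_closed0 up); apply: Estar1_antidominant01 => //.
  by apply: leq_trans (max_card _) _; rewrite card_ord.
- have [g hg] := Estar1_ex mu.
  rewrite (Estar1_uniq hf (Estar1_Phi t_neq0 evK ev_q q_indep hz hg)).
  pose T' := pcyc n @: T.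
  have inT' l : (pcyc n l \in T') = (l \in T) by rewrite mem_imset //; apply: perm_inj.
  have up' a b : b \in T' -> beats mu a b -> a \in T'.
    rewrite -[a](permKV (pcyc n)) -[b](permKV (pcyc n)) !inT' -(beats_Phi mu _ _ hz).
    exact: up.
  have := Estar1_Phi t_neq0 evK ev_q q_indep hz (IH _ _ up' hg).
  rewrite msymM estar_sym card_imset; last exact: perm_inj.
  rewrite mulrCA; congr (Estar1 _ _); apply/mnmP=> l.
  by rewrite PhiE mnmDE [RHS]mnmDE PhiE ![mesym1 _ _]mnmE inT' addnAC.
- have [g hg] := Estar1_ex mu; have ij : i != j by rewrite -val_eqE /=; lia.
  have muij : mu i != mu j by lia.
  rewrite (Estar1_uniq hf (Estar1_swap t_neq0 t_inj evK ev_q q_indep hj lt hg)).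
  pose T' := tperm i j @: T.
  have up' a b : b \in T' -> beats mu a b -> a \in T'.
    rewrite !in_tperm_imset => hb hab; apply: up hb _.
    by rewrite beats_swap // !tpermK.
  have rhoT a b : beats mu a b -> (mesym1 T' b <= mesym1 T' a)%N.
    by rewrite !mnmE => /(up' a b); case: (b \in T') => // ->.
  have lt' : ((mu + mesym1 T')%MM j < (mu + mesym1 T')%MM i)%N.
    rewrite !mnmDE -addSn leq_add // rhoT // /beats lt; exact: isT.
  have := Estar1_swap t_neq0 t_inj evK ev_q q_indep hj lt' (IH _ _ up' hg).
  rewrite !kstatD // card_imset; last exact: perm_inj.
  rewrite heckeM ?estar_sym // scalerAr -mulrDr; congr (Estar1 _ _); apply/mnmP=> l.
  by rewrite !mnmE in_tperm_imset tpermK.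
Qed.

(* [eta] is the sum of the indicators of its level sets, all of which are initial
   segments for the common ranking of positions. *)
Lemma Estar1_columns mu eta f : beats mu =2 beats eta -> Estar1 mu f ->
  Estar1 (mu + eta)%MM (estar_part n t (conj_part eta) * f).
Proof.
move=> hb hf; pose trunc k : 'X_{1..n} := [multinom minn (eta i) k | i < n].
pose T k := [set i : 'I_n | (k < eta i)%N].
have mono a b : beats mu a b -> (eta b <= eta a)%N by rewrite hb /beats; lia.
have main k : Estar1 (mu + trunc k)%MM
    ((\prod_(d <- [seq #|T c| | c : nat <- seq.iota 0 k]) estar n t d) * f).
  elim: k => [|k IH].
    suff e : trunc 0%N = 0%MM by rewrite big_nil mul1r e addm0.
    by apply/mnmP=> i; rewrite !mnmE minn0.
  have -> : (mu + trunc k.+1)%MM = (mu + trunc k + mesym1 (T k))%MM.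
    by apply/mnmP=> i; rewrite !mnmDE !mnmE inE; case: ltnP => /=; lia.
  rewrite -addn1 iotaD map_cat big_cat big_seq1 add0n.
  rewrite -mulrA [X in Estar1 _ X]mulrCA.
  apply: Estar1_column IH => a b; rewrite beatsD.
    by rewrite !inE => lt /mono; apply: leq_trans.
  by move=> c d /mono; rewrite !mnmE; lia.
have := main (\max_(i < n) eta i)%N; congr (Estar1 (_ + _)%MM _).
apply/mnmP=> i; rewrite mnmE; apply/minn_idPl; exact: leq_bigmax.
Qed.

(* Both sides come from computing [E*_(mu + eta)] in two ways. *)
Lemma Estar1_ratio mu eta f g : beats mu =2 beats eta -> Estar1 mu f -> Estar1 eta g ->
  tofrac f / tofrac g = tofrac (estar_part n t (conj_part mu)) /
    tofrac (estar_part n t (conj_part eta)) :> {fraction {mpoly K[n]}}.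
Proof.
move=> hb hf hg.
have h1 := Estar1_columns hb hf.
have h2 : Estar1 (mu + eta)%MM (estar_part n t (conj_part mu) * g).
  by rewrite addmC; apply: Estar1_columns => // a b; rewrite hb.
have nz (p : {mpoly K[n]}) nu : Estar1 nu p -> p != 0.
  by move=> hp; apply: contraTneq (oner_neq0 K) => e; rewrite -(Estar1_lead hp) e mcoeff0 eqxx.
(* The denominator on the right is nonzero as a factor of [E*_(mu + eta)], which has leading
   coefficient 1. *)
have := nz _ _ h1; rewrite mulf_eq0 negb_or => /andP[ne _].
apply/eqP; rewrite eqr_div ?tofrac_eq0 ?(nz _ _ hg) // -!tofracM tofrac_eq.
by rewrite (Estar1_uniq h2 h1) mulrC.
Qed.

End Columns.

(** * The fields Q(t) and Q(q, t) *)

Lemma big_mnm (R : Type) (idx : R) (op : Monoid.com_law idx) n (mu : 'X_{1..n}) (F : nat -> R) :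
  \big[op/idx]_(i < n) F (mu i) = \big[op/idx]_(x <- (mu : seq nat)) F x.
Proof. by rewrite big_tuple; apply: eq_bigr => i _; rewrite mnm_tnth. Qed.

Lemma conj_part_rearr n (lam mu : 'X_{1..n}) : mu \in rearr lam ->
  conj_part mu = conj_part lam.
Proof.
rewrite inE => hp; rewrite /conj_part.
have -> : (\max_(i < n) mu i = \max_(i < n) lam i)%N.
  by rewrite !(big_mnm _ _ id); apply: perm_big.
apply: eq_map => j.
have cE (nu : 'X_{1..n}) :
    #|[set i : 'I_n | (j < nu i)%N]| = (\sum_(x <- (nu : seq nat)) (j < x))%N.
  rewrite -big_mnm -sum1_card big_mkcond; apply: eq_bigr => i _.
  by rewrite inE; case: (_ < _)%N.
by rewrite !cE; apply: perm_big.
Qed.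

(** Otherwise exchanging the two parts would preserve the image under [phi] and give a
    lexicographically smaller rearrangement. *)
Lemma lex_min_blocks n (phi : nat -> nat) (lam eta mu : 'X_{1..n}) :
  mu \in rearr lam -> mnm_map phi mu = eta ->
  (forall nu : 'X_{1..n}, nu \in rearr lam -> mnm_map phi nu = eta -> lex_le mu nu) ->
  forall i j : 'I_n, (i < j)%N -> eta i = eta j -> (mu i <= mu j)%N.
Proof.
move=> hmu heta hmin i j ij e; rewrite leqNgt; apply/negP=> lt.
have mapE (nu : 'X_{1..n}) l : mnm_map phi nu l = phi (nu l) by rewrite mnmE.
have hs : swap i j mu \in rearr lam.
  rewrite inE (perm_trans _ (hmu : perm_eq mu lam)) // perm_sym.
  apply/tuple_permP; exists (tperm i j); congr (tval _); apply: eq_from_tnth => l.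
  by rewrite tnth_mktuple -!mnm_tnth mnmE tpermK.
have /hmin : mnm_map phi (swap i j mu) = eta.
  apply/mnmP=> l; rewrite mapE mnmE -heta mapE.
  by case: tpermP => // ->; move: e; rewrite -heta !mapE.
move/(_ hs)/Order.POrderTheory.le_gtF/negbT/negP; apply.
apply/Order.TupleLexiOrder.ltxi_tuplePlt; exists i => [l li|].
  rewrite -!mnm_tnth swapE -!val_eqE /=.
  by have [-> ->] : (l == i :> nat) = false /\ (l == j :> nat) = false by lia.
by rewrite -!mnm_tnth swapL.
Qed.

Section PolynomialsInQ.
Variables (K : fieldType) (t : K) (n : nat).
Hypotheses (t_neq0 : t != 0) (t_inj : injective (fun k : nat => t ^+ k)).
Implicit Types (mu nu : 'X_{1..n}).

Local Notation A := {poly K}.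
Local Notation L := {fraction {poly K}}.
Let iota : {rmorphism K -> A} := @polyC K.
Let ev : {rmorphism A -> K} := horner_eval 1.
Local Notation tL := (tofrac t%:P : L).
Local Notation qL := (tofrac 'X : L).

Lemma ev_iota : cancel iota ev.
Proof. by move=> c; rewrite /= /horner_eval hornerC. Qed.

Lemma ev_X : ev 'X = 1.
Proof. by rewrite /= /horner_eval hornerX. Qed.

Lemma X_indep (a : nat) (c d : K) : 'X ^+ a.+1 * iota c = iota d -> c = 0.
Proof.
move/(congr1 (fun p : {poly K} => p`_a.+1)).
by rewrite coefXnM ltnn subnn !coefC.
Qed.

Local Notation Estar1 := (Estar1 t 'X iota ev).
Local Notation interpolates := (interpolates t 'X iota ev).

Lemma tofrac_pt nu i : tofrac (pt t 'X iota nu i) = spectral qL tL nu i.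
Proof.
rewrite /spectral /pt mulrC tofracM tofracXn; congr (_ * _).
rewrite -tofracXn -[RHS]mul1r; apply: (canRL (mulfK _)).
  by rewrite tofrac_eq0 expf_neq0 // polyC_eq0 t_neq0.
rewrite -tofracM /= -polyC_exp -polyCM mulVf ?expf_neq0 ?t_neq0 //.
Qed.

Lemma is_Estar_good mu P : interpolates mu P ->
  is_Estar qL tL mu ((tofrac P@_mu)^-1 *: map_mpoly (@tofrac A) P).
Proof.
case=> h1 h2 h3 h4 h5.
have inj : injective (@tofrac A) by move=> a b /eqP; rewrite tofrac_eq => /eqP.
split.
- by move=> m /msuppZ_le; rewrite (perm_mem (msupp_map_mpoly _ inj)); apply: h1.
- rewrite mcoeffZ mcoeff_map_mpoly mulVf // tofrac_eq0.
  by apply: contraNneq h5 => ->; rewrite rmorph0.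
- move=> nu hd hne; rewrite mevalZ.
  rewrite -(meval_eq _ (tofrac_pt nu)) meval_map h2 //.
  by rewrite (rmorph0 (@tofrac A)) mulr0.
Qed.

Lemma is_Estar_uniq mu E E' :
  is_Estar qL tL mu E -> is_Estar qL tL mu E' -> E = E'.
Proof.
have inj : injective (@tofrac A) by move=> a b /eqP; rewrite tofrac_eq => /eqP.
have vanish d (D : {mpoly L[n]}) : (forall m, m \in msupp D -> (mdeg m <= d)%N) ->
    (forall nu, (mdeg nu <= d)%N -> D.@[spectral qL tL nu] = 0) -> D = 0.
  move=> hd hv; apply: (interpolates_inj_uniq t_neq0 t_inj ev_iota ev_X X_indep inj hd) => nu hnu.
  by rewrite -[RHS](hv nu hnu); apply: meval_eq => i; apply: tofrac_pt.
move=> [hE cE vE] [hE' cE' vE'].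
set s := spectral qL tL mu.
have e : E'.@[s] *: E = E.@[s] *: E'.
  apply/eqP; rewrite -subr_eq0; apply/eqP; apply: (vanish (mdeg mu)).
    by move=> m /msuppB_le; rewrite mem_cat => /orP[]/msuppZ_le; [apply: hE|apply: hE'].
  move=> nu hnu; rewrite mevalB !mevalZ.
  have [->|hne] := eqVneq nu mu; first by rewrite mulrC subrr.
  by move: (vE nu hnu hne) (vE' nu hnu hne) => -> ->; rewrite !mulr0 subrr.
have e1 : E'.@[s] = E.@[s].
  by have := congr1 (mcoeff mu) e; rewrite !mcoeffZ cE cE' !mulr1.
have nz : E.@[s] != 0.
  apply/eqP=> z; have E0 : E = 0.
    apply: (vanish (mdeg mu) _ hE) => nu hnu.
    by have [->|hne] := eqVneq nu mu; [exact: z|apply: vE].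
  by move: cE; rewrite E0 mcoeff0 => /esym/eqP; rewrite oner_eq0.
apply/mpolyP=> m; apply: (mulfI nz).
by have := congr1 (mcoeff m) e; rewrite !mcoeffZ e1.
Qed.

(** By uniqueness, the choice in [Estar] returns the normalized [P]. Its coefficients are the
    quotients by [P@_mu], regular at 1 because [P@_mu] does not vanish there. *)
Lemma Estar_value mu f : Estar1 mu f -> mpoly_value 1 (Estar qL tL mu) f.
Proof.
move=> [P hP eP]; have hE := is_Estar_good hP.
have -> : mpoly_value 1 (Estar qL tL mu) f = mpoly_value 1
    ((tofrac P@_mu)^-1 *: map_mpoly (@tofrac A) P : {mpoly L[n]}) f.
  congr (mpoly_value 1 _ f); apply: (is_Estar_uniq _ hE).
  apply: (epsilon_spec (inhabits 0) (is_Estar qL tL mu)); eexists; exact: hE.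
case: hP => _ _ _ _ z m; exists P@_m, P@_mu; split; first exact: z.
  by rewrite mcoeffZ mcoeff_map_mpoly mulrC.
have := congr1 (mcoeff m) eP; rewrite mcoeff_map_mpoly mcoeffZ => e.
by apply: (canRL (mulfK z)); rewrite mulrC -e.
Qed.

End PolynomialsInQ.

Lemma tQt_neq0 : tQt != 0.
Proof. by rewrite /tQt tofrac_eq0 polyX_eq0. Qed.

Lemma tQt_inj : injective (fun k : nat => tQt ^+ k).
Proof.
move=> a b /= /eqP; rewrite /tQt -!tofracXn tofrac_eq => /eqP/(congr1 (size : {poly rat} -> nat)).
by rewrite !size_polyXn => -[].
Qed.

Lemma meval_mesym n (R : comNzRingType) k (v : 'I_n -> R) :
  (mesym n R k).@[v] = \sum_(S : {set 'I_n} | #|S| == k) \prod_(l in S) v l.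
Proof.
rewrite /mesym (raddf_sum (meval v)); apply: eq_bigr => S _ /=.
by rewrite (rmorph_prod (meval v)); apply: eq_bigr => l _; rewrite /= mevalXU.
Qed.

(** Putting 1 for the variable gives the number of subsets of size [k], which is positive and so
    nonzero in characteristic zero. *)
Lemma mesym_geom_neq0 (F : numFieldType) n k : (k <= n)%N ->
  (mesym n {fraction {poly F}} k).@[fun l : 'I_n => tofrac 'X ^+ l] != 0.
Proof.
move=> kn; pose p : {poly F} := \sum_(S : {set 'I_n} | #|S| == k) \prod_(l in S) 'X ^+ l.
have -> : (mesym n {fraction {poly F}} k).@[fun l : 'I_n => tofrac 'X ^+ l] = tofrac p.
  rewrite meval_mesym /p (raddf_sum (@tofrac {poly F})); apply: eq_bigr => S _ /=.
  rewrite (rmorph_prod (@tofrac {poly F})); apply: eq_bigr => l _ /=.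
  by rewrite tofracXn.
rewrite tofrac_eq0; apply/eqP=> /(congr1 (horner^~ 1)) /=.
rewrite /p horner_sum horner0 (eq_bigr (fun=> 1)) => [|S _]; last first.
  by rewrite horner_prod big1 // => l _; rewrite hornerXn expr1n.
rewrite sumr_const => /eqP; rewrite Num.Theory.pnatr_eq0.
apply/negP; rewrite -lt0n; apply/card_gt0P; exists (iset n k).
by apply/eqP; apply: card_iset.
Qed.

Theorem theoremB3 (n : nat) (phi : nat -> nat)
    (phi_mono : forall i j : nat, (i <= j)%N -> (phi i <= phi j)%N)
    (lam kap : 'X_{1..n}) (lam_part : is_part lam) (kap_part : is_part kap)
    (phi_lam : mnm_map phi lam = kap)
    (eta : 'X_{1..n}) (eta_kap : eta \in rearr kap)
    (mu : 'X_{1..n}) (mu_lam : mu \in rearr lam)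
    (phi_mu : mnm_map phi mu = eta)
    (mu_min : forall nu : 'X_{1..n}, nu \in rearr lam ->
       mnm_map phi nu = eta -> lex_le mu nu) :
  exists Emu Eeta : {mpoly Qt[n]},
    [/\ Estar_q1 mu Emu, Estar_q1 eta Eeta
      & tofrac Emu / tofrac Eeta =
        tofrac (estar_part n tQt (conj_part lam))
        / tofrac (estar_part n tQt (conj_part kap))
        :> {fraction {mpoly Qt[n]}}].
Proof.
have [f hf] := Estar1_ex tQt_neq0 tQt_inj (@ev_iota Qt) (@ev_X Qt) (@X_indep Qt) mu.
have [g hg] := Estar1_ex tQt_neq0 tQt_inj (@ev_iota Qt) (@ev_X Qt) (@X_indep Qt) eta.
exists f, g; split; try exact: (Estar_value tQt_neq0 tQt_inj).
rewrite -(conj_part_rearr mu_lam) -(conj_part_rearr eta_kap).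
apply: (Estar1_ratio tQt_neq0 tQt_inj (@ev_iota Qt) (@ev_X Qt) (@X_indep Qt)
  (@mesym_geom_neq0 rat n)) hf hg => a b.
have etaE l : eta l = phi (mu l) by rewrite -phi_mu mnmE.
have blk := lex_min_blocks mu_lam phi_mu mu_min.
(* Strict inequalities in [eta] lift to [mu] by monotonicity. Positions tied in [eta] are ranked
   right to left, and [mu] ranks them the same way because it increases weakly along them. *)
have := phi_mono (mu a) (mu b); have := phi_mono (mu b) (mu a).
have := blk a b; have := blk b a; rewrite /beats !etaE.
by case: (ltngtP a b) => // [h|h|/val_inj ->]; lia.
Qed.
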